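(* Let $H,d\in\mathbb{N}$, $N\in\mathbb{N}\cap[1,H]$, $x_0,x_1,\ldots,x_N,a\in\mathbb{R}$, $b\in(a,\infty)$, $f\in C([a,b],\mathbb{R})$ satisfy $d=3H+1$ and $a=x_0<x_1<\cdots<x_N=b$, and assume for all $i\in\{1,2,\ldots,N\}$ that $f|_{[x_{i-1},x_i]}$ is affine linear. Let $R_r\in C(\mathbb{R},\mathbb{R})$, $r\in\mathbb{N}\cup\{\infty\}$, satisfy for all $x\in\mathbb{R}$ that $\{R_r:r\in\mathbb{N}\}\subseteq C^1(\mathbb{R},\mathbb{R})$, $R_\infty(x)=\max\{x,0\}$, $\sup_{r\in\mathbb{N}}\sup_{y\in[-|x|,|x|]}|(R_r)'(y)|<\infty$, and $$\limsup_{r\to\infty}\bigl(|R_r(x)-R_\infty(x)|+|(R_r)'(x)-\mathbf{1}_{(0,\infty)}(x)|\bigr)=0.$$ Let $p\colon[a,b]\to(0,\infty)$ be Lipschitz continuous, and let $L_r\colon\mathbb{R}^d\to\mathbb{R}$, $r\in\mathbb{N}\cup\{\infty\}$, satisfy for all $r\in\mathbb{N}\cup\{\infty\}$, $\theta=(\theta_1,\ldots,\theta_d)\in\mathbb{R}^d$ that $$L_r(\theta)=\int_a^b\Bigl(f(x)-\theta_d-\sum_{j=1}^H\theta_{2H+j}\,R_r(\theta_jx+\theta_{H+j})\Bigr)^2p(x)\,\mathrm{d}x .$$ Let $(\Omega,\mathcal{F},\mathbb{P})$ be a probability space, let $\Theta_n^\gamma\colon\Omega\to\mathbb{R}^d$,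 $\gamma\in\mathbb{R}$, $n\in\mathbb{N}_0$, be random variables, assume for every $\gamma\in\mathbb{R}$ that $\Theta_0^\gamma$ is standard normally distributed, let $G\colon\mathbb{R}^d\to\mathbb{R}^d$ satisfy for all $\theta\in\{\vartheta\in\mathbb{R}^d:((\nabla L_r)(\vartheta))_{r\in\mathbb{N}}\text{ is convergent}\}$ that $G(\theta)=\lim_{r\to\infty}(\nabla L_r)(\theta)$, and assume for all $\gamma\in\mathbb{R}$, $n\in\mathbb{N}_0$, $\omega\in\Omega$ that $$\Theta_{n+1}^\gamma(\omega)=\Theta_n^\gamma(\omega)-\gamma\,G(\Theta_n^\gamma(\omega)).$$ Then there exist $c,C\in(0,\infty)$ such that for all $\gamma\in(0,c]$ it holds that $$\mathbb{P}\Bigl(\limsup_{n\to\infty}L_\infty(\Theta_n^\gamma)=0\Bigr)\ \ge\ \mathbb{P}\bigl(\forall\,n\in\mathbb{N}_0: L_\infty(\Theta_n^\gamma)\le C\exp(-c\gamma n)\bigr)\ \ge\ c\ >\ 0 .$$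
   Context: $\mathbb{N}=\{1,2,3,\ldots\}$, $\mathbb{N}_0=\mathbb{N}\cup\{0\}$; $\mathbf{1}_A$ is the indicator function of $A$. The function $G$ is arbitrary at points where the sequence of gradients does not converge. *)

(* Defs.v *)
From HB Require Import structures.
From mathcomp Require Import all_boot all_order all_algebra.
From mathcomp Require Import all_classical all_reals all_analysis.
Import Order.TTheory GRing.Theory Num.Theory.
Import numFieldNormedType.Exports.

Set Implicit Arguments.
Unset Strict Implicit.
Unset Printing Implicit Defensive.

Local Open Scope classical_set_scope.
Local Open Scope ring_scope.

(* theta_k for 1 <= k <= 3H+1: the paper's coordinates are numbered from 1,
   those of a row vector from 0. *)
Definition coord (R : realType) (H : nat) (theta : 'rV[R]_(3 * H).+1)
  (k : nat) : R := theta ord0 (inord k.-1).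

Definition C1 (R : realType) (g : R -> R) : Prop :=
  (forall x, derivable g x 1) /\ continuous (g^`()%classic).

Definition affine_on (R : realType) (D : set R) (g : R -> R) : Prop :=
  exists u v : R, forall x, D x -> g x = u * x + v.

Definition realization (R : realType) (H : nat) (A : R -> R)
    (theta : 'rV[R]_(3 * H).+1) (x : R) : R :=
  coord theta (3 * H).+1 +
  \sum_(1 <= j < H.+1) coord theta (2 * H + j)%N *
     A (coord theta j * x + coord theta (H + j)%N).

Definition risk (R : realType) (H : nat) (a b : R) (f p A : R -> R)
    (theta : 'rV[R]_(3 * H).+1) : R :=
  \int[lebesgue_measure]_(x in `[a, b])
    ((f x - realization A theta x) ^+ 2 * p x).

Definition gradient (R : realType) (n : nat) (F : 'rV[R]_n.+1 -> R)
    (theta : 'rV[R]_n.+1) : 'rV[R]_n.+1 :=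
  \row_i 'D_(delta_mx ord0 i) F theta.

(* Row vectors carry a topology but no sigma-algebra in the library:
   measurability is with respect to the Borel sets. *)
Definition random_vector (R : realType) (d : measure_display)
    (Omega : measurableType d) (n : nat) (X : Omega -> 'rV[R]_n.+1) : Prop :=
  forall B : set 'rV[R]_n.+1, <<s [set U : set 'rV[R]_n.+1 | open U] >> B ->
    measurable (X @^-1` B).

(* The law of X is the product of n+1 copies of N(0,1), expressed on the
   measurable boxes, which determine it. *)
Definition standard_normal (R : realType) (d : measure_display)
    (Omega : measurableType d) (P : probability Omega R) (n : nat)
    (X : Omega -> 'rV[R]_n.+1) : Prop :=
  forall B : 'I_n.+1 -> set R, (forall i, measurable (B i)) ->
    P [set w | forall i, B i (X w ord0 i)] =
    (\prod_(i < n.+1) normal_prob 0 1 (B i))%E.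

(* Main.v *)
(* Near a suitable global minimizer t0 the risk satisfies a Lojasiewicz
   inequality m L <= |G|^2, although L need not be convex there, so that gradient
   descent started close to t0 converges exponentially.

   The generalized gradient G is computed everywhere by dominated convergence:
   it is obtained from the derivative of the network in which R_oo' is replaced
   by the indicator of (0, +oo).  In t0 one neuron is active on all of [a, b],
   one neuron with nonzero outer weight sits at each true kink of f, and the
   others are inactive.  For t near t0 the error e = N_t - f differs from
   g = sum_j D_j 1_{z_j > 0}, where D_j = v_j z_j - v_j^0 z_j^0 is affine, only
   where |z_j^0| is small, and there by at most |D_j|.  Let M be the size of
   the coefficients of the D_j.  Between the kinks g is a partial sum of the
   D_j, hence |g| ~ M in L^2; moreover g is the derivative of N_t in a direction
   of length at most C M.  Thus |G| M >= c <e, g> >= c M^2 and L <= C M^2.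

   The expansion L(t + h) <= L(t) + <G(t), h> + K |h|^2 needs no second
   derivative: a neuron is not linear in the step only where its sign changes,
   a set of measure O(|h|) on which the error is O(|h|).  Both inequalities
   bound the step length by C (sqrt L(t_n) - sqrt L(t_{n+1})), which telescopes
   and keeps the iterates near t0.  A Gaussian start is close enough to t0 with
   positive probability. *)

Require Import Defs.
From HB Require Import structures.
From mathcomp Require Import all_boot all_order all_algebra.
From mathcomp Require Import all_classical all_reals all_analysis.
From mathcomp Require Import measurable_realfun ring lra zify.
Import Order.TTheory GRing.Theory Num.Theory.
Import numFieldNormedType.Exports.

Local Open Scope classical_set_scope.
Local Open Scope ring_scope.

Set Implicit Arguments.
Unset Strict Implicit.
Unset Printing Implicit Defensive.

Local Notation coord := Defs.coord.

(** * Weighted integration on [a, b] *)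

Section weighted_integral.
Context {R : realType} (a b : R).
Local Notation mu := (@lebesgue_measure R).
Local Notation I := (`[a, b]%classic : set R).
Implicit Types g h p : R -> R.

(** This class is stable under sums and products and lies in [L^1] because the interval has finite
    measure; every integrability condition below reduces to membership in it. *)
Definition bounded_measurable g :=
  measurable_fun I g /\ exists K, forall x, I x -> `|g x| <= K.

Lemma bounded_measurable_cst c : bounded_measurable (fun=> c).
Proof. by split; [exact: measurable_cst|exists `|c|]. Qed.

Lemma bounded_measurableD g h : bounded_measurable g ->
  bounded_measurable h -> bounded_measurable (fun x => g x + h x).
Proof.
move=> [mg [K gK]] [mh [L hL]]; split; first exact: measurable_funD.
by exists (K + L) => x Ix; rewrite (le_trans (ler_normD _ _))// lerD ?gK ?hL.
Qed.

Lemma bounded_measurableM g h : bounded_measurable g ->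
  bounded_measurable h -> bounded_measurable (fun x => g x * h x).
Proof.
move=> [mg [K gK]] [mh [L hL]]; split; first exact: measurable_funM.
by exists (K * L) => x Ix; rewrite normrM ler_pM ?gK ?hL.
Qed.

Lemma bounded_measurableZ c g : bounded_measurable g ->
  bounded_measurable (fun x => c * g x).
Proof. exact: bounded_measurableM (bounded_measurable_cst c). Qed.

Lemma bounded_measurableN g : bounded_measurable g ->
  bounded_measurable (fun x => - g x).
Proof.
move=> /(bounded_measurableZ (-1)).
by under [X in bounded_measurable X]eq_fun do rewrite mulN1r.
Qed.

Lemma bounded_measurableB g h : bounded_measurable g ->
  bounded_measurable h -> bounded_measurable (fun x => g x - h x).
Proof. by move=> bg /bounded_measurableN; exact: bounded_measurableD. Qed.

Lemma bounded_measurable_norm g : bounded_measurable g ->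
  bounded_measurable (fun x => `|g x|).
Proof.
move=> [mg [K gK]]; split; first exact: measurableT_comp.
by exists K => x Ix; rewrite normr_id gK.
Qed.

Lemma bounded_measurable_sqr g : bounded_measurable g ->
  bounded_measurable (fun x => g x ^+ 2).
Proof.
move=> bg; under [X in bounded_measurable X]eq_fun do rewrite expr2.
exact: bounded_measurableM.
Qed.

Lemma bounded_measurable_sum (J : Type) (r : seq J) (P : pred J)
    (F : J -> R -> R) :
  (forall j, bounded_measurable (F j)) ->
  bounded_measurable (fun x => \sum_(j <- r | P j) F j x).
Proof.
move=> bF; elim: r => [|j r IH].
  under [X in bounded_measurable X]eq_fun do rewrite big_nil.
  exact: bounded_measurable_cst.
under [X in bounded_measurable X]eq_fun do rewrite big_cons.
by case: (P j) => //; exact: bounded_measurableD.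
Qed.

Lemma bounded_measurable_cont g : {within I, continuous g} ->
  bounded_measurable g.
Proof.
move=> cg; split; first by apply: subspace_continuous_measurable_fun.
have [ab|ba] := leP a b; last first.
  by exists 0 => x /=; rewrite in_itv/= => /andP[? ?]; exfalso; lra.
have [M Mmax hM] := EVT_max ab cg; have [m mmin hm] := EVT_min ab cg.
exists (`|g M| + `|g m|) => x Ix.
have := hM _ Ix; have := hm _ Ix; rewrite ler_norml => ? ?.
have := ler_norm (g M); have := ler_norm (- g m); rewrite normrN => ? ?.
have := normr_ge0 (g M); have := normr_ge0 (g m) => ? ?.
apply/andP; split; lra.
Qed.

Lemma bounded_measurable_continuous g : continuous g -> bounded_measurable g.
Proof. by move=> cg; apply: bounded_measurable_cont; exact: continuous_subspaceT. Qed.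

Lemma bounded_measurable_id : bounded_measurable id.
Proof. by apply: bounded_measurable_continuous => x; exact: cvg_id. Qed.

(** Indicators are encoded as booleans cast to [R], so that they multiply with the other integrands
    over the fixed domain [a, b]. *)
Lemma bounded_measurable_bool (q : R -> bool) :
  measurable_fun I q -> bounded_measurable (fun x => (q x)%:R).
Proof.
move=> mq; split.
  rewrite (_ : (fun _ => _) = (fun x => if q x then 1 else 0)); last first.
    by apply/funext => x; case: (q x).
  by apply: measurable_fun_if => //; exact: measurable_cst.
by exists 1 => x _; case: (q x); rewrite ?normr1 ?normr0 ?ler01.
Qed.

Lemma bounded_measurable_integrable g : bounded_measurable g ->
  mu.-integrable I (EFin \o g).
Proof.
move=> [mg [K gK]]; apply: measurable_bounded_integrable => //.
  rewrite /= lebesgue_measure_itv; case: ifP => // _; exact: ltry.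
exists K; split; first exact: num_real.
by move=> M KM x Ix; rewrite /= (le_trans (gK _ Ix)) ?ltW.
Qed.

Definition wint p g : R := \int[mu]_(x in I) (g x * p x).

Context (p : R -> R) (bp : bounded_measurable p)
  (p_ge0 : forall x, I x -> 0 <= p x).

Let int g : bounded_measurable g ->
  mu.-integrable I (EFin \o (fun x => g x * p x)).
Proof.
by move=> bg; apply: bounded_measurable_integrable; exact: bounded_measurableM.
Qed.

Lemma eq_wint g h : (forall x, I x -> g x = h x) -> wint p g = wint p h.
Proof. by move=> gh; apply: eq_Rintegral => x /set_mem Ix; rewrite gh. Qed.

Lemma wintD g h : bounded_measurable g -> bounded_measurable h ->
  wint p (fun x => g x + h x) = wint p g + wint p h.
Proof.
move=> bg bh; rewrite /wint -RintegralD//; try exact: int.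
by apply: eq_Rintegral => x _; rewrite mulrDl.
Qed.

Lemma wintZ c g : bounded_measurable g ->
  wint p (fun x => c * g x) = c * wint p g.
Proof.
move=> bg; rewrite /wint -RintegralZl//; try exact: int.
by apply: eq_Rintegral => x _; rewrite mulrA.
Qed.

Lemma wint0 : wint p (fun=> 0) = 0.
Proof.
rewrite -[RHS](mul0r (wint p (fun=> 0))) -(wintZ _ (bounded_measurable_cst 0)).
by apply: eq_wint => x _; rewrite mul0r.
Qed.

Lemma wint_sum (J : Type) (r : seq J) (F : J -> R -> R) :
  (forall j, bounded_measurable (F j)) ->
  wint p (fun x => \sum_(j <- r) F j x) = \sum_(j <- r) wint p (F j).
Proof.
move=> bF; elim: r => [|j r IH].
  by rewrite big_nil -[RHS]wint0; apply: eq_wint => x _; rewrite big_nil.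
rewrite big_cons -IH -wintD//; last exact: bounded_measurable_sum.
by apply: eq_wint => x _; rewrite big_cons.
Qed.

Lemma wint_le g h : bounded_measurable g -> bounded_measurable h ->
  (forall x, I x -> g x <= h x) -> wint p g <= wint p h.
Proof.
move=> bg bh gh; apply: le_Rintegral => //; try exact: int.
by move=> x Ix; rewrite ler_wpM2r ?p_ge0// gh.
Qed.

Lemma wint_ge0 g : (forall x, I x -> 0 <= g x) -> 0 <= wint p g.
Proof. by move=> g0; apply: Rintegral_ge0 => x Ix; rewrite mulr_ge0 ?g0 ?p_ge0. Qed.

Lemma ler_norm_wint g : bounded_measurable g ->
  `|wint p g| <= wint p (fun x => `|g x|).
Proof.
move=> bg; rewrite ler_norml -mulN1r -wintZ; last exact: bounded_measurable_norm.
by apply/andP; split; apply: wint_le => //;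
  try (by do ?apply: bounded_measurableZ; try exact: bounded_measurable_norm);
  move=> x _; have := ler_norm (g x); have := ler_norm (- g x);
  rewrite normrN => ? ?; lra.
Qed.

Lemma bounded_measurable_itv (s t : R) :
  bounded_measurable (fun x => (s <= x <= t)%R%:R).
Proof.
apply: bounded_measurable_bool; apply: measurable_and.
  by apply: measurable_fun_ler => //; exact: measurable_cst.
by apply: measurable_fun_ler => //; exact: measurable_cst.
Qed.

Lemma integral_itv_sub (s t : R) : a <= s -> s <= t -> t <= b ->
  \int[mu]_(x in I) (s <= x <= t)%R%:R = t - s.
Proof.
move=> as_ st tb.
rewrite (_ : (fun _ => _) = (cst 1 : R -> R) \_ (`[s, t]%classic : set R)); last first.
  apply/funext => x; rewrite patchE mem_setE in_itv/=.
  by case: (_ <= _ <= _).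
rewrite -Rintegral_mkcondr (_ : I `&` _ = `[s, t]%classic); last first.
  apply/seteqP; split => x /=; rewrite !in_itv/=; first by case.
  by move=> /andP[? ?]; split; apply/andP; split => //; lra.
rewrite Rintegral_cst// mul1r /= lebesgue_measure_itv/= lte_fin.
case: ltP => [_|]; first by rewrite -EFinB.
by move=> ts /=; lra.
Qed.

Lemma wint_itv_ge s t c : 0 <= c -> (forall x, I x -> c <= p x) ->
  a <= s -> s <= t -> t <= b ->
  c * (t - s) <= wint p (fun x => (s <= x <= t)%R%:R).
Proof.
move=> c0 cp as_ st tb; rewrite -(integral_itv_sub as_ st tb).
rewrite -RintegralZl//; last first.
  by apply: bounded_measurable_integrable; exact: bounded_measurable_itv.
apply: le_Rintegral => //.
- apply: bounded_measurable_integrable.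
  by apply: bounded_measurableZ; exact: bounded_measurable_itv.
- by apply: int; exact: bounded_measurable_itv.
- by move=> x Ix; rewrite mulrC ler_wpM2l ?ler0n// cp.
Qed.

(** The interval may stick out of [a, b], as the strips around kinks do; clipping it to [a, b] only
    shortens it. *)
Lemma wint_itv_le s t c : 0 <= c -> (forall x, I x -> p x <= c) -> s <= t ->
  wint p (fun x => (s <= x <= t)%R%:R) <= c * (t - s).
Proof.
move=> c0 cp st.
(* If the two intervals are disjoint, clipping could reverse the endpoints; a common point [x]
   excludes this. *)
have [e0|] := pselect (forall x, I x -> ~~ (s <= x <= t)).
  rewrite (@eq_wint _ (fun=> 0)) ?wint0 ?mulr_ge0 ?subr_ge0//.
  by move=> x /e0 /negbTE ->.
move=> /existsNP[x /not_implyP[]] /=; rewrite in_itv/= => /andP[ax xb].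
move/negP; rewrite negbK => /andP[sx xt].
pose s' := Num.max s a; pose t' := Num.min t b.
have ss' : s <= s' by rewrite le_max lexx.
have as' : a <= s' by rewrite le_max lexx orbT.
have tt' : t' <= t by rewrite ge_min lexx.
have tb' : t' <= b by rewrite ge_min lexx orbT.
have st' : s' <= t' by rewrite le_min !ge_max; apply/andP; split; apply/andP; split; lra.
apply: (@le_trans _ _ (c * (t' - s'))); last by rewrite ler_wpM2l; lra.
rewrite (@eq_wint _ (fun x => (s' <= x <= t')%R%:R)); last first.
  move=> y /=; rewrite in_itv/= => /andP[ay yb].
  by rewrite ge_max le_min ay yb /= !andbT.
rewrite -(integral_itv_sub as' st' tb').
rewrite -RintegralZl//; last first.
  by apply: bounded_measurable_integrable; exact: bounded_measurable_itv.
apply: le_Rintegral => //.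
- by apply: int; exact: bounded_measurable_itv.
- apply: bounded_measurable_integrable.
  by apply: bounded_measurableZ; exact: bounded_measurable_itv.
- by move=> y Iy; rewrite mulrC ler_wpM2r ?ler0n// cp.
Qed.

End weighted_integral.

(** * The network and its differential *)

Section row_vectors.
Context {R : realType} {n : nat}.
Implicit Types u v : 'rV[R]_n.

Lemma rV_norm_le u K : 0 <= K -> (forall i, `|u ord0 i| <= K) -> `|u| <= K.
Proof.
move=> K0 uK; rewrite /Num.Def.normr/= mx_normrE; apply: bigmax_le => // -[i j] _.
by rewrite ord1.
Qed.

Lemma rV_norm_ge u i : `|u ord0 i| <= `|u|.
Proof.
rewrite [leRHS]/Num.Def.normr/= mx_normrE.
exact: (@le_bigmax _ _ _ 0 (fun ij : 'I_1 * 'I_n => `|u ij.1 ij.2|) (ord0, i)).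
Qed.

Lemma cvg_rV (u_ : nat -> 'rV[R]_n) u :
  (forall i, u_ k ord0 i @[k --> \oo] --> u ord0 i) -> u_ k @[k --> \oo] --> u.
Proof.
move=> uc; apply/cvgrPdist_le => e e0; near=> k.
apply: rV_norm_le => [|i]; first exact: ltW.
rewrite !mxE; move: i; near: k; apply: filter_forall => i.
by have /cvgrPdist_le/(_ e e0) := uc i.
Unshelve. all: by end_near. Qed.

End row_vectors.

Lemma ler_norm_sum_nat (R : realType) (n : nat) (F : nat -> R) (K : R) :
  (forall j, (1 <= j <= n)%N -> `|F j| <= K) ->
  `|\sum_(1 <= j < n.+1) F j| <= n%:R * K.
Proof.
move=> FK; rewrite (le_trans (ler_norm_sum _ _ _))//.
have -> : n%:R * K = \sum_(1 <= j < n.+1) K.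
  by rewrite sumr_const_nat subn1 /= mulr_natl.
by apply: ler_sum_nat => j; rewrite ltnS; exact: FK.
Qed.

Section network.
Context {R : realType} {H : nat}.
Implicit Types (A dA : R -> R) (t h : 'rV[R]_(3 * H).+1) (x : R).

Definition preact t j x : R := coord t j * x + coord t (H + j)%N.

(* The differential of the realization at [t] in the direction [h], when [dA]
   is the derivative of the activation [A]. *)
Definition tangent A dA t h x : R :=
  coord h (3 * H).+1 +
  \sum_(1 <= j < H.+1) (coord h (2 * H + j)%N * A (preact t j x) +
    coord t (2 * H + j)%N * (dA (preact t j x) * preact h j x)).

Lemma coordD t h k : coord (t + h) k = coord t k + coord h k.
Proof. by rewrite /coord mxE. Qed.

Lemma coordZ c t k : coord (c *: t) k = c * coord t k.
Proof. by rewrite /coord mxE. Qed.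

Lemma coordB t h k : coord (t - h) k = coord t k - coord h k.
Proof. by rewrite /coord !mxE. Qed.

Lemma coord_norm t k : `|coord t k| <= `|t|.
Proof. exact: rV_norm_ge. Qed.

Lemma preactD t h j x : preact (t + h) j x = preact t j x + preact h j x.
Proof. by rewrite /preact !coordD; ring. Qed.

Lemma preactB t h j x : preact (t - h) j x = preact t j x - preact h j x.
Proof. by rewrite /preact !coordB; ring. Qed.

Lemma preactZ c t j x : preact (c *: t) j x = c * preact t j x.
Proof. by rewrite /preact !coordZ; ring. Qed.

Lemma preact_norm t j x : `|preact t j x| <= `|t| * (1 + `|x|).
Proof.
rewrite (le_trans (ler_normD _ _))// normrM mulrDr mulr1 addrC lerD ?coord_norm//.
by rewrite ler_wpM2r ?coord_norm.
Qed.

Lemma tangentD A dA t h1 h2 x :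
  tangent A dA t (h1 + h2) x = tangent A dA t h1 x + tangent A dA t h2 x.
Proof.
rewrite /tangent coordD addrACA -big_split; congr (_ + _).
by apply: eq_bigr => j _ /=; rewrite coordD preactD; ring.
Qed.

Lemma tangentZ A dA t c h x : tangent A dA t (c *: h) x = c * tangent A dA t h x.
Proof.
rewrite /tangent coordZ mulrDr mulr_sumr; congr (_ + _).
by apply: eq_bigr => j _ /=; rewrite coordZ preactZ; ring.
Qed.

Lemma tangent_sum A dA t h x : tangent A dA t h x =
  \sum_i h ord0 i * tangent A dA t (delta_mx ord0 i) x.
Proof.
have t0 : tangent A dA t 0 x = 0 by rewrite -(scale0r t) tangentZ mul0r.
rewrite [in LHS](row_sum_delta h).
under [RHS]eq_bigr do rewrite -tangentZ.
apply: (big_morph (fun h => tangent A dA t h x)) => // h1 h2.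
exact: tangentD.
Qed.

(** Every preactivation has size at most [B * Y], so only bounds of the activation on that range
    enter. Leaving [A] general lets the estimate serve both the smooth activations and the
    rectifier. *)
Lemma realization_norm A t x B Y K : `|t| <= B -> 1 + `|x| <= Y ->
  (forall y, `|y| <= B * Y -> `|A y| <= K) ->
  `|realization A t x| <= B + H%:R * (B * K).
Proof.
move=> tB xY AK; rewrite (le_trans (ler_normD _ _))// lerD//.
  exact: le_trans (coord_norm _ _) tB.
apply: ler_norm_sum_nat => j _; rewrite normrM.
have B0 : 0 <= B by exact: le_trans (normr_ge0 _) tB.
rewrite ler_pM//; first exact: le_trans (coord_norm _ _) tB.
apply: AK; apply: le_trans (preact_norm _ _ _) _.
by rewrite ler_pM// addr_ge0.
Qed.

Lemma tangent_norm A dA t h x B Y K Kd : `|t| <= B -> 1 + `|x| <= Y ->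
  (forall y, `|y| <= B * Y -> `|A y| <= K) ->
  (forall y, `|y| <= B * Y -> `|dA y| <= Kd) ->
  `|tangent A dA t h x| <= `|h| * (1 + H%:R * (K + B * (Kd * Y))).
Proof.
move=> tB xY AK AKd; rewrite (le_trans (ler_normD _ _))//.
rewrite [leRHS]mulrDr mulr1 lerD ?coord_norm//.
rewrite [leRHS]mulrCA; apply: ler_norm_sum_nat => j _.
have B0 : 0 <= B by exact: le_trans (normr_ge0 _) tB.
have zB : `|preact t j x| <= B * Y.
  by apply: le_trans (preact_norm _ _ _) _; rewrite ler_pM// addr_ge0.
have AK1 := AK _ zB; have AKd1 := AKd _ zB.
rewrite (le_trans (ler_normD _ _))// !normrM mulrDr lerD//.
  by rewrite ler_pM ?coord_norm.
have hY : `|preact h j x| <= `|h| * Y.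
  by rewrite (le_trans (preact_norm _ _ _))// ler_wpM2l.
rewrite (_ : `|h| * _ = B * (Kd * (`|h| * Y))); last by ring.
by rewrite ler_pM ?mulr_ge0 ?ler_pM// (le_trans (coord_norm _ _)).
Qed.

End network.

(** * Gradients of the smoothed risks *)

Section gradient.
Context {R : realType} {H : nat} (a b : R).
Local Notation mu := (@lebesgue_measure R).
Local Notation I := (`[a, b]%classic : set R).
Implicit Types (A dA : R -> R) (t h : 'rV[R]_(3 * H).+1) (x s : R).

Lemma is_derive_sum_seq (J : Type) (r : seq J) (F : J -> R -> R) (dF : J -> R)
    (s : R) : (forall j, is_derive s 1 (F j) (dF j)) ->
  is_derive s 1 (fun s => \sum_(j <- r) F j s) (\sum_(j <- r) dF j).
Proof.
move=> dFj; elim: r => [|j r IH].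
  rewrite big_nil (_ : (fun _ => _) = cst 0); first exact: is_derive_cst.
  by apply/funext => y; rewrite big_nil.
rewrite big_cons (_ : (fun _ => _) = F j + fun s => \sum_(j <- r) F j s).
  exact: is_deriveD.
by apply/funext => y; rewrite big_cons.
Qed.

Lemma is_derive_affine (c d s : R) : is_derive s 1 (fun s => s * c + d) c.
Proof.
rewrite (_ : (fun _ => _) = (c \*: id) + cst d); last first.
  by apply/funext => y; rewrite !fctE /GRing.scale/= mulrC.
by apply: is_derive_eq; rewrite addr0 /GRing.scale/= mulr1.
Qed.

Lemma coord_line t h s k : coord (s *: h + t) k = s * coord h k + coord t k.
Proof. by rewrite coordD coordZ. Qed.

Lemma preact_line t h j x s :
  preact (s *: h + t) j x = s * preact h j x + preact t j x.
Proof. by rewrite preactD preactZ. Qed.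

(** Along a line in parameter space all preactivations and outer weights are affine in [s], so the
    chain and product rules in one variable suffice. *)
Lemma is_derive_realization A t h x s : (forall y, derivable A y 1) ->
  is_derive s 1 (fun s => realization A (s *: h + t) x)
    (tangent A A^`()%classic (s *: h + t) h x).
Proof.
move=> dA.
rewrite (_ : (fun _ => _) = (fun s => s * coord h (3 * H).+1 + coord t (3 * H).+1)
  + fun s => \sum_(1 <= j < H.+1) (s * coord h (2 * H + j)%N + coord t (2 * H + j)%N)
      * A (s * preact h j x + preact t j x)); last first.
  apply/funext => y; rewrite /realization !fctE coord_line; congr (_ + _).
  by apply: eq_bigr => j _; rewrite -preact_line -coord_line.
apply: is_deriveD; first exact: is_derive_affine.
apply: is_derive_sum_seq => j.
have dz := is_derive_affine (preact h j x) (preact t j x) s.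
have dAz : is_derive (s * preact h j x + preact t j x) 1 A
    (A^`()%classic (s * preact h j x + preact t j x)).
  by apply: DeriveDef => //; rewrite derive1E.
have dAc := @is_derive1_comp _ A _ s _ _ dAz dz.
have dv := is_derive_affine (coord h (2 * H + j)) (coord t (2 * H + j)) s.
have dM := is_deriveM dv dAc; apply: (is_derive_eq dM).
by rewrite preact_line coord_line /GRing.scale/=; ring.
Qed.

Lemma continuous_bounded A (Z : R) : continuous A ->
  exists2 K : R, 0 <= K & forall y, `|y| <= Z -> `|A y| <= K.
Proof.
move=> cA; have [_ [K AK]] := bounded_measurable_continuous (- Z) Z cA.
exists `|K| => // y yZ; apply: le_trans (ler_norm _).
by apply: AK; rewrite /= in_itv/= -ler_norml.
Qed.

Lemma bounded_measurable_preact t j : bounded_measurable a b (preact t j).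
Proof.
apply: bounded_measurableD; last exact: bounded_measurable_cst.
by apply: bounded_measurableM; [exact: bounded_measurable_cst|exact: bounded_measurable_id].
Qed.

Lemma continuous_preact t j : continuous (preact t j).
Proof.
move=> x; apply: cvgD; last exact: cvg_cst.
by apply: cvgM; [exact: cvg_cst|exact: cvg_id].
Qed.

Lemma continuous_act_preact A t j : continuous A ->
  continuous (fun x => A (preact t j x)).
Proof.
by move=> cA x; apply: continuous_comp; [exact: continuous_preact|exact: cA].
Qed.

Lemma bounded_measurable_realization A t : continuous A ->
  bounded_measurable a b (realization A t).
Proof.
move=> cA; apply: bounded_measurableD; first exact: bounded_measurable_cst.
apply: bounded_measurable_sum => j; apply: bounded_measurableZ.
exact/bounded_measurable_continuous/continuous_act_preact.
Qed.

Lemma bounded_measurable_tangent A dA t h : continuous A ->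
  (forall j, bounded_measurable a b (fun x => dA (preact t j x))) ->
  bounded_measurable a b (tangent A dA t h).
Proof.
move=> cA bdA; apply: bounded_measurableD; first exact: bounded_measurable_cst.
apply: bounded_measurable_sum => j; apply: bounded_measurableD.
  apply: bounded_measurableZ.
  exact/bounded_measurable_continuous/continuous_act_preact.
apply: bounded_measurableZ; apply: bounded_measurableM => //.
exact: bounded_measurable_preact.
Qed.

Lemma itv_norm_bound x : I x -> 1 + `|x| <= 1 + `|a| + `|b|.
Proof.
rewrite /= in_itv/= => /andP[ax xb]; rewrite -addrA lerD2l ler_norml.
have := ler_norm b; have := ler_norm (- a); rewrite normrN.
have := normr_ge0 a; have := normr_ge0 b => *; apply/andP; split; lra.
Qed.

Section gradient_formula.
Context (f p : R -> R) (bf : bounded_measurable a b f)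
  (bp : bounded_measurable a b p).

(** The squared error differentiated formally under the integral. Keeping [dA] apart from [A] allows
    the rectifier together with an indicator as its derivative. *)
Definition risk_gradient A dA t : 'rV[R]_(3 * H).+1 :=
  \row_i wint a b p (fun x =>
    2 * (realization A t x - f x) * tangent A dA t (delta_mx ord0 i) x).

(** Differentiation under the integral sign along a coordinate direction, with a dominating function
    valid for all parameters [s *: h + t] with [s] between -1 and 1. *)
Lemma gradient_risk A t : C1 A ->
  gradient (risk a b f p A) t = risk_gradient A A^`()%classic t.
Proof.
move=> [dA cdA]; apply/rowP => i; rewrite !mxE.
set h := delta_mx ord0 i.
have cA : continuous A.
  by move=> y; apply: differentiable_continuous; apply/derivable1_diffP.
pose F s x := (f x - realization A (s *: h + t) x) ^+ 2 * p x.
have dF s x : is_derive s 1 (F ^~ x) (2 * (realization A (s *: h + t) x - f x) *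
    tangent A A^`()%classic (s *: h + t) h x * p x).
  have dN := is_derive_realization t h x s dA.
  have df := @is_derive_cst _ _ _ (f x) s (1 : R).
  have dfN := is_deriveB df dN.
  have dX := is_deriveM dfN dfN.
  have dp := @is_derive_cst _ _ _ (p x) s (1 : R).
  have dM := is_deriveM dX dp; apply: (is_derive_eq dM).
  by rewrite !fctE /GRing.scale/= sub0r; ring.
have bF s : bounded_measurable a b (F s).
  apply: bounded_measurableM => //; apply: bounded_measurable_sqr.
  by apply: bounded_measurableB => //; exact: bounded_measurable_realization.
have d1F s x : partial1of2 F s x = 2 * (realization A (s *: h + t) x - f x) *
    tangent A A^`()%classic (s *: h + t) h x * p x.
  by rewrite partial1of2E; apply: derive_val.
(* [B] bounds the parameters on the segment and [Y] bounds [1 + |x|], so all arguments of [A] and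
   its derivative lie in [[- B * Y, B * Y]]. *)
pose Y := 1 + `|a| + `|b|; pose B := `|h| + `|t|.
have Y0 : 0 <= Y by rewrite !addr_ge0.
have B0 : 0 <= B by rewrite !addr_ge0.
have [K K0 AK] := continuous_bounded (B * Y) cA.
have [Kd Kd0 dAK] := continuous_bounded (B * Y) cdA.
have [_ [Kf fK]] := bf.
(* [K1] and [K2] are the bounds of [realization_norm] and [tangent_norm]. *)
pose K1 := B + H%:R * (B * K).
pose K2 := `|h| * (1 + H%:R * (K + B * (Kd * Y))).
have K10 : 0 <= K1 by rewrite addr_ge0 ?mulr_ge0.
have K20 : 0 <= K2 by rewrite mulr_ge0 ?addr_ge0 ?mulr_ge0 ?addr_ge0 ?mulr_ge0.
have := @cvg_differentiation_under_integral R _ _ mu F I _ 0 (-1) 1 _ _ _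
  (fun x => 2 * (K1 + `|Kf|) * K2 * `|p x|) _ _ _.
move=> /(_ (measurable_itv _)) cvgF.
rewrite /derive.
have -> : (fun s => s^-1 *: ((risk a b f p A \o shift t) (s *: h) - risk a b f p A t))
  = (fun s => s^-1 *: (\int[mu]_(x in I) F (s + 0) x - \int[mu]_(x in I) F 0 x)).
  apply/funext => s; rewrite /risk /F /= addr0; congr (_ *: (_ - _)).
  by rewrite scale0r add0r.
apply/cvg_lim => //.
rewrite (_ : wint _ _ _ _ = \int[mu]_(y in I) partial1of2 F 0 y); last first.
  by apply: eq_Rintegral => x _; rewrite d1F scale0r add0r.
apply: cvgF.
- by rewrite /= in_itv/=; apply/andP; split; lra.
- by move=> s _; apply: bounded_measurable_integrable.
- by move=> s x _ _; case: (dF s x).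
- by move=> x; do 3 ?apply: mulr_ge0 => //; exact: addr_ge0.
- apply: bounded_measurable_integrable; apply: bounded_measurableZ.
  exact: bounded_measurable_norm.
- move=> s x; rewrite /= in_itv/= => /andP[s1 s2] Ix.
  have xY : 1 + `|x| <= Y by apply: itv_norm_bound.
  have tB : `|s *: h + t| <= B.
    rewrite (le_trans (ler_normD _ _))// lerD2r normrZ ler_piMl//.
    by rewrite ler_norml; apply/andP; split; exact: ltW.
  rewrite d1F !normrM ler_wpM2r//; apply: ler_pM => //.
    rewrite normr_nat ler_wpM2l// (le_trans (ler_normB _ _))// lerD//.
      exact: realization_norm tB xY AK.
    by rewrite (le_trans (fK _ Ix))// ler_norm.
  exact: tangent_norm tB xY AK dAK.
Qed.

End gradient_formula.
End gradient.

(** * Passage of the gradients to the limit by dominated convergence *)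

Section gradient_limit.
Context {R : realType} {H : nat} (a b : R).
Local Notation mu := (@lebesgue_measure R).
Local Notation I := (`[a, b]%classic : set R).
Implicit Types (t h : 'rV[R]_(3 * H).+1) (x s : R).

Lemma cvg_sum_seq (J : Type) (r : seq J) (F : nat -> J -> R) (l : J -> R) :
  (forall j, F k j @[k --> \oo] --> l j) ->
  \sum_(j <- r) F k j @[k --> \oo] --> \sum_(j <- r) l j.
Proof.
move=> Fl; elim: r => [|j r IH].
  by rewrite big_nil; under eq_fun do rewrite big_nil; exact: cvg_cst.
by rewrite big_cons; under eq_fun do rewrite big_cons; exact: cvgD.
Qed.

Context (A_ dA_ : nat -> R -> R) (A dA : R -> R).
Hypothesis A_cvg : forall y, A_ k y @[k --> \oo] --> A y.
Hypothesis dA_cvg : forall y, dA_ k y @[k --> \oo] --> dA y.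

Lemma cvg_realization t x :
  realization (A_ k) t x @[k --> \oo] --> realization A t x.
Proof.
apply: cvgD; first exact: cvg_cst.
by apply: cvg_sum_seq => j; apply: cvgM; [exact: cvg_cst|exact: A_cvg].
Qed.

Lemma cvg_tangent t h x :
  tangent (A_ k) (dA_ k) t h x @[k --> \oo] --> tangent A dA t h x.
Proof.
apply: cvgD; first exact: cvg_cst.
apply: cvg_sum_seq => j; apply: cvgD.
  by apply: cvgM; [exact: cvg_cst|exact: A_cvg].
apply: cvgM; first exact: cvg_cst.
by apply: cvgM; [exact: dA_cvg|exact: cvg_cst].
Qed.

Context (f p : R -> R) (bf : bounded_measurable a b f)
  (bp : bounded_measurable a b p).
Hypothesis A_cont : forall k, continuous (A_ k).
Hypothesis dA_cont : forall k, continuous (dA_ k).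
Hypothesis A_bound : forall Z, exists2 K : R, 0 <= K &
  forall k y, `|y| <= Z -> `|A_ k y| <= K.
Hypothesis dA_bound : forall Z, exists2 K : R, 0 <= K &
  forall k y, `|y| <= Z -> `|dA_ k y| <= K.

(** For fixed [t] the preactivations stay in a compact range, so locally uniform bounds on the
    activations and their derivatives give an integrable majorant for each coordinate. *)
Lemma cvg_risk_gradient t :
  risk_gradient a b f p (A_ k) (dA_ k) t @[k --> \oo] -->
  risk_gradient a b f p A dA t.
Proof.
apply: cvg_rV => i; rewrite mxE; under eq_fun do rewrite mxE.
set h := delta_mx ord0 i.
pose F k x := 2 * (realization (A_ k) t x - f x) *
  tangent (A_ k) (dA_ k) t h x * p x.
have bF k : bounded_measurable a b (F k).
  apply: bounded_measurableM => //; apply: bounded_measurableM.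
    apply: bounded_measurableZ; apply: bounded_measurableB => //.
    exact: bounded_measurable_realization.
  apply: bounded_measurable_tangent => // j.
  exact/bounded_measurable_continuous/continuous_act_preact.
pose Y := 1 + `|a| + `|b|; pose B := `|t|.
have Y0 : 0 <= Y by rewrite !addr_ge0.
have B0 : 0 <= B by exact: normr_ge0.
have [K K0 AK] := A_bound (B * Y).
have [Kd Kd0 dAK] := dA_bound (B * Y).
have [_ [Kf fK]] := bf.
pose K1 := B + H%:R * (B * K).
pose K2 := `|h| * (1 + H%:R * (K + B * (Kd * Y))).
have K10 : 0 <= K1 by rewrite addr_ge0 ?mulr_ge0.
have K20 : 0 <= K2 by rewrite mulr_ge0 ?addr_ge0 ?mulr_ge0 ?addr_ge0 ?mulr_ge0.
have bG : bounded_measurable a b (fun x => 2 * (K1 + `|Kf|) * K2 * `|p x|).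
  by apply: bounded_measurableZ; exact: bounded_measurable_norm.
pose Fl x := 2 * (realization A t x - f x) * tangent A dA t h x * p x.
have F_cvg x : F k x @[k --> \oo] --> Fl x.
  apply: cvgM; last exact: cvg_cst.
  apply: cvgM; last exact: cvg_tangent.
  apply: cvgM; first exact: cvg_cst.
  by apply: cvgB; [exact: cvg_realization|exact: cvg_cst].
have F_le k x : I x -> `|F k x| <= 2 * (K1 + `|Kf|) * K2 * `|p x|.
  move=> Ix; have xY : 1 + `|x| <= Y by apply: itv_norm_bound.
  rewrite !normrM ler_wpM2r//; apply: ler_pM => //.
    rewrite normr_nat ler_wpM2l// (le_trans (ler_normB _ _))// lerD//.
      exact: realization_norm (lexx _) xY (AK k).
    by rewrite (le_trans (fK _ Ix))// ler_norm.
  exact: tangent_norm (lexx _) xY (AK k) (dAK k).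
have [||||||iFl _ cF] := @dominated_convergence _ _ _ mu I _
    (fun k x => (F k x)%:E) (fun x => (Fl x)%:E)
    (fun x => (2 * (K1 + `|Kf|) * K2 * `|p x|)%:E).
- by [].
- by move=> k; apply/measurable_EFinP; case: (bF k).
- apply/measurable_EFinP; apply: (@measurable_fun_cvg _ _ _ _ F) => [k|x _].
    by case: (bF k).
  exact: F_cvg.
- by apply: aeW => x _; apply: cvg_EFin; [exact: nearW|exact: F_cvg].
- exact: bounded_measurable_integrable.
- by apply: aeW => x k Ix; rewrite lee_fin F_le.
have -> : wint a b p (fun x => 2 * (realization A t x - f x) * tangent A dA t h x)
  = fine (\int[mu]_(x in I) (Fl x)%:E)%E by [].
apply: (@fine_cvg _ _ _ _ (fun k => (\int[mu]_(x in I) (F k x)%:E)%E)).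
by rewrite fineK//; exact: integrable_fin_num.
Qed.

End gradient_limit.

(** * Pointwise limits and local bounds of the smooth activations *)

Section activation_limit.
Context {R : realType} (A : nat -> R -> R) (Aoo : R -> R).

Definition step (x : R) : R := (0 < x)%R%:R.

Hypothesis hAC1 : forall r : nat, (1 <= r)%N -> C1 (A r).
Hypothesis hAbound : forall x : R,
  (ereal_sup [set ereal_sup [set `|(A r)^`()%classic y|%:E
                            | y in `[(- `|x|)%R, `|x|%R]]
             | r in [set r : nat | (1 <= r)%N]] < +oo)%E.
Hypothesis hAlim : forall x : R,
  limn_esup (fun r : nat =>
    (`|A r x - Aoo x| + `|(A r)^`()%classic x - \1_(`]0, +oo[%classic) x|)%:E)
  = 0%E.

(** A nonnegative sequence whose upper limit is 0 converges to 0. *)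
Lemma activation_cvg0 x :
  `|A r x - Aoo x| + `|(A r)^`()%classic x - step x| @[r --> \oo] --> (0 : R).
Proof.
apply: (@fine_cvg _ _ _ _ (fun r : nat => (`|A r x - Aoo x| +
  `|(A r)^`()%classic x - step x|)%:E)).
apply: limn_esup_le_cvg => [|n]; last by rewrite lee_fin addr_ge0.
rewrite -[X in (_ <= X)%E](hAlim x) le_eqVlt; apply/orP; left; apply/eqP.
congr limn_esup; apply/funext => r; congr (_ + `|_ - _|)%:E.
by rewrite /step indicE mem_setE in_itv/= andbT.
Qed.

Lemma activation_cvg x : A r x @[r --> \oo] --> Aoo x.
Proof.
apply/cvgrPdist_le => e e0.
have /cvgrPdist_le/(_ e e0) := @activation_cvg0 x; apply: filterS => r.
rewrite sub0r normrN distrC; apply: le_trans.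
by rewrite [leRHS]ger0_norm ?addr_ge0// lerDl.
Qed.

Lemma activation_deriv_cvg x : (A r)^`()%classic x @[r --> \oo] --> step x.
Proof.
apply/cvgrPdist_le => e e0.
have /cvgrPdist_le/(_ e e0) := @activation_cvg0 x; apply: filterS => r.
rewrite sub0r normrN [`|step x - _|]distrC; apply: le_trans.
by apply: le_trans (ler_norm _); rewrite lerDr.
Qed.

Lemma activation_deriv_bound (Z : R) : exists2 K : R, 0 <= K &
  forall r y, `|y| <= Z -> `|(A r.+1)^`()%classic y| <= K.
Proof.
have := hAbound Z; set S := ereal_sup _ => Soo.
(* The supremum [S] lies below infinity and dominates a nonnegative number, hence it is finite and
   [fine] keeps its value. *)
exists (Num.max 0 (fine S)) => [|r y yZ]; first by rewrite le_max lexx.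
have yS : ((`|(A r.+1)^`()%classic y|)%:E <= S)%E.
  apply: (@le_trans _ _ (ereal_sup [set `|(A r.+1)^`()%classic y|%:E
      | y in `[(- `|Z|)%R, `|Z|%R]])).
    apply: ereal_sup_ubound; exists y => //.
    by rewrite /= in_itv/= -ler_norml (le_trans yZ)// ler_norm.
  by apply: ereal_sup_ubound; exists r.+1.
have Sfin : S \is a fin_num.
  by rewrite ge0_fin_numE// (le_trans _ yS)// lee_fin.
by rewrite le_max -[X in _ || X]lee_fin fineK// yS orbT.
Qed.

(** The values at 0 form a convergent, hence bounded, sequence; the mean value theorem and the bound
    on the derivatives carry this from 0 to [y]. *)
Lemma activation_bound (Z : R) : exists2 K : R, 0 <= K &
  forall r y, `|y| <= Z -> `|A r.+1 y| <= K.
Proof.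
have [K K0 dAK] := activation_deriv_bound Z.
have /cvg_seq_bounded : cvgn (fun r => A r.+1 0).
  by apply/cvg_ex; exists (Aoo 0); rewrite (cvg_shiftS (A ^~ 0)); exact: activation_cvg.
(* Boundedness supplies the bounds strictly above [M]; the choice [|M| + 1] is one of them. *)
move=> [M [_ AM]]; exists (`|M| + 1 + K * `|Z|); first by rewrite !addr_ge0 ?mulr_ge0.
move=> r y yZ.
have A0 : `|A r.+1 0| <= `|M| + 1 by apply: AM => //; rewrite (le_lt_trans (ler_norm _))// ltrDl.
have dA (x : R) : is_derive x 1 (A r.+1) ((A r.+1)^`()%classic x).
  by have [dA _] := hAC1 (ltn0Sn r); apply: DeriveDef => //; rewrite derive1E.
have cA (u v : R) : {within `[u, v], continuous (A r.+1)}.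
  apply: continuous_subspaceT => x; apply: differentiable_continuous.
  by apply/derivable1_diffP; have [+ _] := hAC1 (ltn0Sn r); exact.
have yZ' : `|y| <= `|Z| by rewrite (le_trans yZ)// ler_norm.
suff: `|A r.+1 y - A r.+1 0| <= K * `|Z|.
  move=> h; rewrite -[X in `|X|](subrK (A r.+1 0)) addrC.
  by rewrite (le_trans (ler_normD _ _))// lerD.
have [y0|/ltW y0] := leP 0 y.
  have [c + ->] := MVT_segment y0 (fun x _ => dA x) (cA _ _).
  rewrite in_itv/= => /andP[c0 cy]; rewrite subr0 normrM ler_pM//.
  by apply: dAK; rewrite ger0_norm// (le_trans cy)// (le_trans (ler_norm _)).
rewrite distrC.
have [c + ->] := MVT_segment y0 (fun x _ => dA x) (cA _ _).
rewrite in_itv/= => /andP[cy c0]; rewrite sub0r normrM normrN ler_pM//.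
by apply: dAK; rewrite ler0_norm// (le_trans _ yZ)// ler0_norm// lerN2.
Qed.

End activation_limit.

(** * Descent inequality *)

Section relu.
Context {R : realType}.
Implicit Types x y u v : R.

Definition relu x : R := Num.max x 0.

Lemma reluE x : relu x = x * step x.
Proof.
by rewrite /relu /step; case: (ltP 0 x) => x0; rewrite ?mulr1 ?mulr0.
Qed.

Lemma relu_lipschitz u v : `|relu u - relu v| <= `|u - v|.
Proof.
rewrite !reluE /step; case: (ltP 0 u) => u0; case: (ltP 0 v) => v0;
  rewrite ?mulr1 ?mulr0 ?subr0 ?sub0r ?normrN ?subrr ?normr0 //.
  rewrite !ger0_norm; lra.
by rewrite gtr0_norm// ler0_norm; lra.
Qed.

Lemma relu_norm u : `|relu u| <= `|u|.
Proof. by rewrite reluE normrM ler_piMr// /step; case: (0 < u); rewrite ?normr1 ?normr0. Qed.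

(** The linearization at [v] is exact unless [u] and [v] lie on different sides of 0, and then 0 is
    between them. The indicator involves only the base point and the step length, so its integral
    can be bounded independently of [u]. *)
Lemma relu_remainder u v : `|relu u - relu v - step v * (u - v)| <=
  `|u - v| * (`|v| <= `|u - v|)%R%:R.
Proof.
rewrite !reluE /step; case: (ltP 0 u) => u0; case: (ltP 0 v) => v0;
  rewrite ?mulr1 ?mulr0 ?mul1r ?mul0r ?subr0 ?sub0r ?subrr ?normr0 ?mulr_ge0//.
- rewrite !(ler0_norm v0) !(@gtr0_norm _ u) // !(@ger0_norm _ (u - v)); try lra.
  by rewrite (_ : (- v <= u - v)) ?mulr1; lra.
- rewrite !(gtr0_norm v0) !(@ler0_norm _ (u - v)); try lra.
  rewrite (_ : (v <= - (u - v))) ?mulr1; last lra.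
  by rewrite ger0_norm; lra.
Qed.

Lemma continuous_relu : continuous relu.
Proof.
move=> x; apply/cvgrPdist_le => e e0; near=> y.
by rewrite (le_trans (relu_lipschitz _ _))//; near: y; exact: cvgr_dist_le.
Unshelve. all: by end_near. Qed.

End relu.

Section descent.
Context {R : realType} {H : nat} (a b : R).
Local Notation I := (`[a, b]%classic : set R).
Implicit Types (t h : 'rV[R]_(3 * H).+1) (x s : R).
Let Y : R := 1 + `|a| + `|b|.

Let Y0 : 0 <= Y. Proof. by rewrite !addr_ge0. Qed.

Let xY x : I x -> 1 + `|x| <= Y. Proof. exact: itv_norm_bound. Qed.

Let zY t j x : I x -> `|preact t j x| <= Y * `|t|.
Proof. by move=> Ix; rewrite (le_trans (preact_norm _ _ _))// mulrC ler_wpM2r ?xY. Qed.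

(* A neuron is linearized with a quadratic error, except where its sign may
   change, that is, where its preactivation is at most [Y * `|h|]. *)
Lemma realization_remainder t h x B : `|t| <= B -> I x ->
  `|realization relu (t + h) x - realization relu t x - tangent relu step t h x|
  <= \sum_(1 <= j < H.+1) (Y * `|h| ^+ 2 +
       B * (Y * `|h|) * (`|preact t j x| <= Y * `|h|)%R%:R).
Proof.
move=> tB Ix; rewrite /realization /tangent coordD.
(* Per neuron, the remainder is the change of the outer weight times the increment of the rectifier,
   plus the old outer weight times the linearization error of the rectifier. *)
rewrite (_ : _ - _ - _ = \sum_(1 <= j < H.+1)
  (coord h (2 * H + j)%N * (relu (preact (t + h) j x) - relu (preact t j x)) +
   coord t (2 * H + j)%N * (relu (preact (t + h) j x) - relu (preact t j x)
     - step (preact t j x) * (preact (t + h) j x - preact t j x)))); last first.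
  rewrite -/(preact _ _ _) [RHS](_ : _ = \sum_(1 <= j < H.+1)
      (coord (t + h) (2 * H + j)%N * relu (preact (t + h) j x)) -
    \sum_(1 <= j < H.+1) (coord t (2 * H + j)%N * relu (preact t j x)) -
    \sum_(1 <= j < H.+1) (coord h (2 * H + j)%N * relu (preact t j x) +
      coord t (2 * H + j)%N * (step (preact t j x) * preact h j x))); last first.
    rewrite -!sumrB; apply: eq_bigr => j _.
    by rewrite coordD preactD; ring.
  by rewrite /preact; ring.
rewrite (le_trans (ler_norm_sum _ _ _))//; apply: ler_sum => j _.
have hY : `|preact (t + h) j x - preact t j x| <= Y * `|h|.
  by rewrite preactD addrAC subrr add0r zY.
rewrite (le_trans (ler_normD _ _))// !normrM lerD//.
  rewrite expr2 mulrCA ler_pM ?coord_norm//.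
  exact: le_trans (relu_lipschitz _ _) hY.
rewrite -mulrA ler_pM//; first exact: le_trans (coord_norm _ _) tB.
rewrite (le_trans (relu_remainder _ _))// ler_pM//.
rewrite ler_nat; case: leP => //= h1.
by rewrite (le_trans h1 hY).
Qed.

Lemma realization_lipschitz B : 0 <= B -> exists2 K : R, 0 <= K &
  forall t h x, `|t| <= B -> `|h| <= 1 -> I x ->
  `|realization relu (t + h) x - realization relu t x| <= K * `|h|.
Proof.
move=> B0.
(* This is the bound of [tangent_norm] for the rectifier: values at most [B * Y], derivative at most
   1. The remainder is then bounded crudely, with indicators replaced by 1 and the square of the
   step by the step. *)
pose K2 := 1 + H%:R * (B * Y + B * (1 * Y)).
exists (K2 + H%:R * (Y + B * Y)).
  by rewrite !addr_ge0 ?mulr_ge0 ?addr_ge0 ?mulr_ge0.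
move=> t h x tB h1 Ix.
rewrite -[X in `|X|](subrK (tangent relu step t h x)).
rewrite (le_trans (ler_normD _ _))// addrC mulrDl lerD//.
  rewrite [leRHS]mulrC; apply: (tangent_norm _ tB (xY Ix)) => y yB.
    exact: le_trans (relu_norm _) yB.
  by rewrite /step; case: (0 < y); rewrite ?normr1 ?normr0.
rewrite (le_trans (realization_remainder _ tB Ix))//.
apply: (le_trans (ler_norm _)); rewrite -mulrA; apply: ler_norm_sum_nat => j _.
rewrite ger0_norm; last by rewrite addr_ge0 ?mulr_ge0 ?exprn_ge0.
rewrite [leRHS]mulrDl; apply: lerD.
  by rewrite expr2 ler_wpM2l// ler_piMr.
rewrite [leRHS](_ : _ = B * (Y * `|h|)); last by ring.
by rewrite ler_piMr ?mulr_ge0// lern1 leq_b1.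
Qed.

Context (f p : R -> R) (bf : bounded_measurable a b f)
  (bp : bounded_measurable a b p) (p0 : forall x, I x -> 0 <= p x).

Let bN t : bounded_measurable a b (realization relu t).
Proof. by apply: bounded_measurable_realization; exact: continuous_relu. Qed.

Lemma bounded_measurable_step (g : R -> R) : continuous g ->
  bounded_measurable a b (fun x => step (g x)).
Proof.
move=> cg; apply: bounded_measurable_bool; apply: measurable_fun_ltr.
  exact: measurable_cst.
by have [] := bounded_measurable_continuous a b cg.
Qed.

Let bT t h : bounded_measurable a b (tangent relu step t h).
Proof.
apply: bounded_measurable_tangent; first exact: continuous_relu.
by move=> j; apply: bounded_measurable_step; exact: continuous_preact.
Qed.

Lemma riskE A t : risk a b f p A t =
  wint a b p (fun x => (realization A t x - f x) ^+ 2).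
Proof. by apply: eq_Rintegral => x _; rewrite -sqrrN opprB. Qed.

Lemma risk_ge0 A t : 0 <= risk a b f p A t.
Proof. by rewrite riskE; apply: wint_ge0 => // x _; exact: sqr_ge0. Qed.

(** Linearity of [tangent] in the direction collapses the scalar product into one integral, which
    serves both the descent expansion and the lower bound on the gradient. *)
Lemma risk_gradient_dot t h :
  \sum_i risk_gradient a b f p relu step t ord0 i * h ord0 i =
  wint a b p (fun x => 2 * (realization relu t x - f x) * tangent relu step t h x).
Proof.
have bF i : bounded_measurable a b (fun x => 2 * (realization relu t x - f x) *
    tangent relu step t (delta_mx ord0 i) x).
  apply: bounded_measurableM => //; apply: bounded_measurableZ.
  exact: bounded_measurableB.
under eq_bigr do rewrite mxE mulrC -wintZ//.
rewrite -wint_sum//; last by move=> i; exact: bounded_measurableZ.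
apply: eq_wint => x _; rewrite [tangent _ _ _ h _]tangent_sum mulr_sumr.
by apply: eq_bigr => i _; ring.
Qed.

Lemma bounded_measurable_small t j (e : R) :
  bounded_measurable a b (fun x => (`|preact t j x| <= e)%R%:R).
Proof.
apply: bounded_measurable_bool; apply: measurable_fun_ler.
  by apply: measurableT_comp => //; case: (bounded_measurable_preact a b t j).
exact: measurable_cst.
Qed.

Lemma error_bound B : 0 <= B -> exists2 E : R, 0 <= E &
  forall t x, `|t| <= B -> I x -> `|realization relu t x - f x| <= E.
Proof.
move=> B0; have [_ [Kf fK]] := bf.
exists (B + H%:R * (B * (B * Y)) + `|Kf|).
  by rewrite !addr_ge0 ?mulr_ge0.
move=> t x tB Ix; rewrite (le_trans (ler_normB _ _))// lerD//.
  apply: (realization_norm tB (xY Ix)) => y yB.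
  exact: le_trans (relu_norm _) yB.
by rewrite (le_trans (fK _ Ix))// ler_norm.
Qed.

Lemma risk_lipschitz B : 0 <= B -> exists2 K : R, 0 <= K &
  forall t h, `|t| <= B -> `|h| <= 1 ->
  `|risk a b f p relu (t + h) - risk a b f p relu t| <= K * `|h|.
Proof.
move=> B0; have [K K0 NK] := realization_lipschitz B0.
have [E E0 eE] := error_bound B0.
have P0 : 0 <= wint a b p (fun=> 1) by apply: wint_ge0.
exists (K * (K + 2 * E) * wint a b p (fun=> 1)).
  by rewrite !mulr_ge0 ?addr_ge0 ?mulr_ge0.
move=> t h tB h1; rewrite !riskE -mulN1r -(wintZ bp (-1)); last first.
  by apply: bounded_measurable_sqr; exact: bounded_measurableB.
have bsq t' : bounded_measurable a b (fun x => (realization relu t' x - f x) ^+ 2).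
  by apply: bounded_measurable_sqr; exact: bounded_measurableB.
rewrite -wintD//; last exact: bounded_measurableZ.
rewrite (le_trans (ler_norm_wint _ _ _))//.
  by apply: bounded_measurableD => //; exact: bounded_measurableZ.
rewrite mulrAC -wintZ//; last exact: bounded_measurable_cst.
apply: wint_le => //.
- apply: bounded_measurable_norm.
  by apply: bounded_measurableD => //; exact: bounded_measurableZ.
- by apply: bounded_measurableZ; exact: bounded_measurable_cst.
move=> x Ix; rewrite mulr1.
set e' := realization _ (t + h) x - _; set e := realization _ t x - _.
have -> : e' ^+ 2 + -1 * e ^+ 2 = (e' - e) * ((e' - e) + 2 * e) by ring.
have d : `|e' - e| <= K * `|h|.
  by rewrite /e' /e opprB addrA subrK NK.
rewrite normrM mulrAC ler_pM//.
rewrite (le_trans (ler_normD _ _))// lerD//.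
  by rewrite (le_trans d)// ler_piMr.
by rewrite normrM normr_nat ler_wpM2l// eE.
Qed.

Lemma risk_gradient_bound B : 0 <= B -> exists2 K : R, 0 <= K &
  forall t, `|t| <= B -> `|risk_gradient a b f p relu step t| <= K.
Proof.
move=> B0; have [E E0 eE] := error_bound B0.
pose K2 := 1 + H%:R * (B * Y + B * (1 * Y)).
have K20 : 0 <= K2 by rewrite !addr_ge0 ?mulr_ge0 ?addr_ge0 ?mulr_ge0.
have P0 : 0 <= wint a b p (fun=> 1) by apply: wint_ge0.
exists (2 * E * K2 * wint a b p (fun=> 1)); first by rewrite !mulr_ge0.
move=> t tB; apply: rV_norm_le => [|i]; first by rewrite !mulr_ge0.
have bF : bounded_measurable a b (fun x => 2 * (realization relu t x - f x) *
    tangent relu step t (delta_mx ord0 i) x).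
  apply: bounded_measurableM => //; apply: bounded_measurableZ.
  exact: bounded_measurableB.
rewrite mxE (le_trans (ler_norm_wint _ _ _))//.
rewrite -wintZ//; last exact: bounded_measurable_cst.
apply: wint_le => //; first exact: bounded_measurable_norm.
  by apply: bounded_measurableZ; exact: bounded_measurable_cst.
move=> x Ix; rewrite mulr1 !normrM normr_nat ler_pM ?mulr_ge0//.
  by rewrite ler_wpM2l// eE.
have d1 : `|delta_mx ord0 i : 'rV[R]_(3 * H).+1| <= 1.
  apply: rV_norm_le => // k; rewrite mxE; case: (_ && _);
  by rewrite ?normr1 ?normr0.
apply: le_trans (tangent_norm _ tB (xY Ix) _ _) _.
- by move=> y yB; exact: le_trans (relu_norm _) yB.
- by move=> y _; rewrite /step; case: (0 < y); rewrite ?normr1 ?normr0.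
- by rewrite ler_piMl.
Qed.

Lemma risk_descent B kappa : 0 <= B -> 0 <= kappa -> exists2 K : R, 0 <= K &
  forall t h, `|t| <= B -> `|h| <= 1 ->
  (forall j e, (1 <= j <= H)%N -> 0 <= e ->
    wint a b p (fun x => (`|preact t j x| <= e)%R%:R) <= kappa * e) ->
  risk a b f p relu (t + h) <= risk a b f p relu t +
    \sum_i risk_gradient a b f p relu step t ord0 i * h ord0 i + K * `|h| ^+ 2.
Proof.
move=> B0 k0; have [K K0 NK] := realization_lipschitz B0.
have [E E0 eE] := error_bound B0.
pose P := wint a b p (fun=> 1).
have P0 : 0 <= P by apply: wint_ge0.
(* The first summand pays for the linearization error weighted by an error of size at most [E], the
   second for the squared increment of the realization. *)
exists (2 * E * (H%:R * (Y * P + B * Y * (kappa * Y))) + K ^+ 2 * P).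
  by rewrite !(addr_ge0, mulr_ge0)// sqr_ge0.
move=> t h tB h1 transv.
pose e x := realization relu t x - f x.
have be : bounded_measurable a b e by exact: bounded_measurableB.
pose S x := \sum_(1 <= j < H.+1) (Y * `|h| ^+ 2 +
       B * (Y * `|h|) * (`|preact t j x| <= Y * `|h|)%R%:R).
have bSj j : bounded_measurable a b (fun x => Y * `|h| ^+ 2 +
       B * (Y * `|h|) * (`|preact t j x| <= Y * `|h|)%R%:R).
  apply: bounded_measurableD; first exact: bounded_measurable_cst.
  by apply: bounded_measurableZ; exact: bounded_measurable_small.
have bS : bounded_measurable a b S by exact: bounded_measurable_sum.
(* A sign change contributes an amount of order [|h|] on a strip of measure at most
   [kappa * (Y * |h|)], hence a quadratic term after integration. *)
have intS : wint a b p S <=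
    H%:R * (Y * P + B * Y * (kappa * Y)) * `|h| ^+ 2.
  rewrite wint_sum// -mulrA; apply: (le_trans (ler_norm _)).
  apply: ler_norm_sum_nat => j j1; rewrite ger0_norm; last first.
    by apply: wint_ge0 => // x _; rewrite addr_ge0 ?mulr_ge0 ?exprn_ge0.
  rewrite wintD//; [|exact: bounded_measurable_cst|]; last first.
    by apply: bounded_measurableZ; exact: bounded_measurable_small.
  rewrite (@eq_wint _ _ _ _ (fun=> Y * `|h| ^+ 2) (fun=> Y * `|h| ^+ 2 * 1)); last first.
    by move=> x _; rewrite mulr1.
  rewrite wintZ//; last exact: bounded_measurable_cst.
  rewrite wintZ//; last exact: bounded_measurable_small.
  rewrite [leRHS]mulrDl lerD//; first by rewrite mulrAC.
  have := transv j (Y * `|h|) j1 (mulr_ge0 Y0 (normr_ge0 _)).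
  move=> /(ler_wpM2l (mulr_ge0 B0 (mulr_ge0 Y0 (normr_ge0 h)))) /le_trans; apply.
  by rewrite le_eqVlt; apply/orP; left; apply/eqP; ring.
rewrite !riskE risk_gradient_dot.
have bsq t' : bounded_measurable a b (fun x => (realization relu t' x - f x) ^+ 2).
  by apply: bounded_measurable_sqr; exact: bounded_measurableB.
have be2 : bounded_measurable a b (fun x => e x ^+ 2) by exact: bsq.
have beT : bounded_measurable a b (fun x => 2 * e x * tangent relu step t h x).
  by apply: bounded_measurableM => //; exact: bounded_measurableZ.
apply: (@le_trans _ _ (wint a b p (fun x => e x ^+ 2 +
   2 * e x * tangent relu step t h x + (2 * E * S x + K ^+ 2 * `|h| ^+ 2)))).
  apply: wint_le => //.
    apply: bounded_measurableD; first exact: bounded_measurableD.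
    by apply: bounded_measurableD; [exact: bounded_measurableZ|exact: bounded_measurable_cst].
  move=> x Ix; rewrite -/(e x).
  have := realization_remainder h tB Ix; have := NK _ _ _ tB h1 Ix.
  rewrite -/(S x); set N1 := realization _ (t + h) x; set N0 := realization _ t x.
  set T := tangent _ _ _ _ _ => d1 d2.
  have -> : (N1 - f x) ^+ 2 = e x ^+ 2 + 2 * e x * T +
      (2 * e x * (N1 - N0 - T) + (N1 - N0) ^+ 2) by rewrite /e -/N0; ring.
  rewrite lerD2l lerD//; last first.
    by rewrite -exprMn -[leLHS]real_normK ?num_real// ler_pXn2r// ?nnegrE// mulr_ge0.
  rewrite (le_trans (ler_norm _))// !normrM normr_nat ler_pM ?mulr_ge0//.
  by rewrite ler_wpM2l// eE.
rewrite wintD//; [|exact: bounded_measurableD|]; last first.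
  by apply: bounded_measurableD; [exact: bounded_measurableZ|exact: bounded_measurable_cst].
rewrite wintD// lerD2l wintD//; [|exact: bounded_measurableZ|exact: bounded_measurable_cst].
rewrite wintZ// [leRHS]mulrDl; apply: lerD.
  by rewrite -[leRHS]mulrA ler_wpM2l// mulr_ge0.
rewrite (@eq_wint _ _ _ _ (fun=> K ^+ 2 * `|h| ^+ 2)
  (fun=> K ^+ 2 * `|h| ^+ 2 * 1)); last by move=> x _; rewrite mulr1.
rewrite (wintZ bp _ (bounded_measurable_cst a b 1)) -/P.
by rewrite [leRHS]mulrAC.
Qed.

End descent.

(** * Lojasiewicz inequality *)

Section affine_lower_bound.
Context {R : realType} (a b : R) (p : R -> R) (bp : bounded_measurable a b p).
Local Notation I := (`[a, b]%classic : set R).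
Context (c : R) (c0 : 0 < c) (cp : forall x, I x -> c <= p x).

Let p0 x : I x -> 0 <= p x.
Proof. by move=> /cp; apply: le_trans; exact: ltW. Qed.

(** Here [m] is the larger of the two endpoint values. The slope is at most [2 * m / (e - s)], so
    within a quarter of the length from the maximizing endpoint at most half of [m] is lost. *)
Lemma affine_half_max (s e al be m : R) : s < e ->
  `|al * s + be| <= m -> `|al * e + be| <= m ->
  m = `|al * s + be| \/ m = `|al * e + be| ->
  exists s' e' : R, [/\ s <= s', e' <= e, e' - s' = (e - s) / 4 &
    forall x, s' <= x <= e' -> m / 2 <= `|al * x + be|].
Proof.
move=> se sm em.
have ald : `|al| * (e - s) <= 2 * m.
  rewrite -[e - s]gtr0_norm ?subr_gt0// -normrM.
  rewrite (_ : al * (e - s) = (al * e + be) - (al * s + be)); last by ring.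
  by rewrite (le_trans (ler_normB _ _))// mulr2n mulrDl mul1r lerD.
have quarter y x : `|x - y| <= (e - s) / 4 -> m = `|al * y + be| ->
    m / 2 <= `|al * x + be|.
  move=> xy my.
  have h1 : `|al * (x - y)| <= m / 2.
    rewrite normrM (le_trans (ler_wpM2l (normr_ge0 al) xy))//.
    by rewrite mulrA ler_pdivrMr//; lra.
  have h2 : m <= `|al * x + be| + `|al * (x - y)|.
    rewrite my (_ : al * y + be = (al * x + be) - al * (x - y)); last by ring.
    exact: ler_normB.
  by lra.
case=> my.
- exists s, (s + (e - s) / 4); split=> //; [lra|ring|].
  move=> x /andP[sx xs]; apply: quarter my.
  by rewrite ger0_norm; lra.
- exists (e - (e - s) / 4), e; split=> //; [lra|ring|].
  move=> x /andP[sx xs]; apply: quarter my.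
  by rewrite ler0_norm; lra.
Qed.

(** Equivalence of norms on the two-dimensional space of affine functions, made explicit by keeping
    only the quarter interval of [affine_half_max]. *)
Lemma wint_affine_ge (s e : R) : a <= s -> s < e -> e <= b ->
  exists2 c1 : R, 0 < c1 & forall al be : R, c1 * (`|al| + `|be|) ^+ 2 <=
    wint a b p (fun x => (al * x + be) ^+ 2 * (s <= x <= e)%R%:R).
Proof.
move=> as_ se eb; pose d := e - s; have d0 : 0 < d by rewrite subr_gt0.
(* [C] is chosen so that [|al| + |be| <= C * m]: the endpoint values give the slope, and the value
   at [s] then gives the intercept. The 16 below comes from the square of [m / 2] times a quarter of
   the length. *)
pose C := 2 / d + (1 + 2 / d * `|s|).
have d20 : 0 < 2 / d by rewrite divr_gt0.
have C0 : 0 < C by rewrite ltr_pwDl// addr_ge0// mulr_ge0// ltW.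
exists (c * d / (16 * C ^+ 2)).
  by rewrite divr_gt0 ?mulr_gt0 ?exprn_gt0.
move=> al be.
pose m := Num.max `|al * s + be| `|al * e + be|.
have sm : `|al * s + be| <= m by rewrite le_max lexx.
have em : `|al * e + be| <= m by rewrite le_max lexx orbT.
have m0 : 0 <= m by apply: le_trans sm.
have mE : m = `|al * s + be| \/ m = `|al * e + be|.
  by rewrite /m; case: (leP `|al * s + be|) => _; [right|left].
have [s' [e' [ss' ee' de' lm]]] := affine_half_max se sm em mE.
have ald : `|al| <= 2 / d * m.
  rewrite mulrAC ler_pdivlMr// -[d]gtr0_norm// -normrM.
  rewrite (_ : al * d = (al * e + be) - (al * s + be)); last by rewrite /d; ring.
  by rewrite (le_trans (ler_normB _ _))// mulr2n mulrDl mul1r lerD.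
have bed : `|be| <= m + 2 / d * m * `|s|.
  rewrite (_ : be = (al * s + be) - al * s); last by ring.
  rewrite (le_trans (ler_normB _ _))// lerD// normrM.
  by rewrite ler_wpM2r.
have Cm : `|al| + `|be| <= C * m by rewrite /C mulrDl [(1 + _) * m]mulrDl mul1r lerD// mulrAC.
have Cm2 : (`|al| + `|be|) ^+ 2 <= C ^+ 2 * m ^+ 2.
  by rewrite -exprMn lerXn2r ?nnegrE ?addr_ge0// mulr_ge0// ltW.
apply: (@le_trans _ _ ((m / 2) ^+ 2 * (c * (e' - s')))).
  rewrite de' -/d mulrAC ler_pdivrMr ?mulr_gt0 ?exprn_gt0//.
  apply: (le_trans (ler_wpM2l _ Cm2)); first by rewrite mulr_ge0 ?ltW.
  by rewrite le_eqVlt; apply/orP; left; apply/eqP; field.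
have de0 : s' <= e' by rewrite -subr_ge0 de' divr_ge0// ltW.
apply: (@le_trans _ _ ((m / 2) ^+ 2 * wint a b p (fun x => (s' <= x <= e')%R%:R))).
  rewrite ler_wpM2l ?sqr_ge0//; apply: wint_itv_ge => //; first exact: ltW.
    exact: le_trans ss'.
  exact: le_trans eb.
rewrite -wintZ//; last exact: bounded_measurable_itv.
apply: wint_le => //.
- by apply: bounded_measurableZ; exact: bounded_measurable_itv.
- apply: bounded_measurableM; last exact: bounded_measurable_itv.
  apply: bounded_measurable_sqr; apply: bounded_measurableD.
    by apply: bounded_measurableZ; exact: bounded_measurable_id.
  exact: bounded_measurable_cst.
move=> x _; case: (boolP (s' <= x <= e')) => [xse|_]; last first.
  by rewrite mulr0 mulr_ge0 ?sqr_ge0.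
have -> : s <= x <= e.
  by move: xse => /andP[sx xe]; rewrite (le_trans ss' sx) (le_trans xe ee').
rewrite !mulr1 -[leRHS]real_normK ?num_real// lerXn2r ?nnegrE ?divr_ge0//.
exact: lm.
Qed.

End affine_lower_bound.

Lemma uniform_lower_constant (R : realType) (N : nat) (Q : nat -> R -> Prop) :
  (forall k c c', Q k c -> c' <= c -> Q k c') ->
  (forall k, (k <= N)%N -> exists2 c : R, 0 < c & Q k c) ->
  exists2 c : R, 0 < c & forall k, (k <= N)%N -> Q k c.
Proof.
move=> Qle; elim: N => [|N IH] QN.
  by have [c c0 Qc] := QN 0%N (leqnn _); exists c => // k; rewrite leqn0 => /eqP ->.
have [c c0 Qc] := QN N.+1 (leqnn _).
have [|c' c0' Qc'] := IH; first by move=> k kN; apply: QN; exact: leqW.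
exists (Num.min c c') => [|k]; first by rewrite lt_min c0.
rewrite leq_eqVlt => /predU1P[->|]; first by apply: Qle Qc _; rewrite ge_min lexx.
by rewrite ltnS => /Qc'/Qle; apply; rewrite ge_min lexx orbT.
Qed.

Lemma opposite_sign_norm_le (R : realType) (X W : R) : X * W <= 0 -> `|X| <= `|W - X|.
Proof.
move=> XW; rewrite -ler_sqr ?nnegrE// !real_normK ?num_real//.
have := sqr_ge0 W; nra.
Qed.

(** * Parameter vectors assembled from their blocks *)

Section parameter_vectors.
Context {R : realType} (H : nat) (w b v : nat -> R) (c : R).

(** The inverse of reading off [coord]: the families are indexed from 1 and the entries of the row
    from 0, hence the successors. *)
Definition param : 'rV[R]_(3 * H).+1 := \row_(i < (3 * H).+1)
  if (i < H)%N then w i.+1 else if (i < 2 * H)%N then b (i - H).+1 else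
  if (i < 3 * H)%N then v (i - 2 * H).+1 else c.

Lemma param_weight j : (1 <= j <= H)%N -> coord param j = w j.
Proof.
move=> jH; rewrite /Defs.coord mxE inordK; last by lia.
have -> : (j.-1 < H)%N by lia.
by rewrite prednK//; lia.
Qed.

Lemma param_bias j : (1 <= j <= H)%N -> coord param (H + j)%N = b j.
Proof.
move=> jH; rewrite /Defs.coord mxE inordK; last by lia.
have -> : ((H + j).-1 < H)%N = false by lia.
have -> : ((H + j).-1 < 2 * H)%N by lia.
by have -> : ((H + j).-1 - H).+1 = j by lia.
Qed.

Lemma param_outer j : (1 <= j <= H)%N -> coord param (2 * H + j)%N = v j.
Proof.
move=> jH; rewrite /Defs.coord mxE inordK; last by lia.
have -> : ((2 * H + j).-1 < H)%N = false by lia.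
have -> : ((2 * H + j).-1 < 2 * H)%N = false by lia.
have -> : ((2 * H + j).-1 < 3 * H)%N by lia.
by have -> : ((2 * H + j).-1 - 2 * H).+1 = j by lia.
Qed.

Lemma param_offset : coord param (3 * H).+1 = c.
Proof.
rewrite /Defs.coord mxE inordK; last by lia.
have -> : ((3 * H).+1.-1 < H)%N = false by lia.
have -> : ((3 * H).+1.-1 < 2 * H)%N = false by lia.
by have -> : ((3 * H).+1.-1 < 3 * H)%N = false by lia.
Qed.

Lemma param_norm K : 0 <= K -> `|c| <= K ->
  (forall j, (1 <= j <= H)%N -> [/\ `|w j| <= K, `|b j| <= K & `|v j| <= K]) ->
  `|param| <= K.
Proof.
move=> K0 cK hK; apply: rV_norm_le => // i; rewrite mxE.
case: ifPn => [h1|h1].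
  by have [] := hK i.+1; first lia.
case: ifPn => [h2|h2].
  by have [] := hK (i - H).+1; first lia.
case: ifPn => [h3|//].
by have [] := hK (i - 2 * H).+1; first lia.
Qed.

End parameter_vectors.

(** * The inequality near an exact minimizer whose neurons switch on one after the other *)

Section lojasiewicz.
Context {R : realType} {H : nat} (a b : R).
Local Notation I := (`[a, b]%classic : set R).
Local Notation Theta := 'rV[R]_(3 * H).+1.
Implicit Types (t h : Theta) (x : R).
Let Y : R := 1 + `|a| + `|b|.

Let Y1 : 1 <= Y. Proof. by rewrite /Y -addrA lerDl addr_ge0. Qed.
Let Y0 : 0 <= Y. Proof. exact: le_trans Y1. Qed.
Let xY x : I x -> 1 + `|x| <= Y. Proof. exact: itv_norm_bound. Qed.

Context (f p : R -> R) (bf : bounded_measurable a b f)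
  (bp : bounded_measurable a b p) (c : R) (c_gt0 : 0 < c)
  (cp : forall x, I x -> c <= p x).

Let p0 x : I x -> 0 <= p x.
Proof. by move=> /cp; apply: le_trans; exact: ltW. Qed.

(** The margin [eta] freezes the signs of the preactivations on the pieces for all parameters close
    to [t0], while [transv] makes the strips of small preactivation thin. The factor 2 in [v_nu]
    leaves outer weights of size at least [nu] after a perturbation by [nu]. *)
Context (H0 : (0 < H)%N) (t0 : Theta)
  (f_t0 : forall x, I x -> f x = realization relu t0 x)
  (nu : R) (nu0 : 0 < nu)
  (v_nu : forall j, (1 <= j <= H)%N -> 2 * nu <= `|coord t0 (2 * H + j)|)
  (N : nat) (act : nat -> bool) (act1 : act 1%N)
  (act_le : forall j, (1 <= j <= H)%N -> act j -> (j <= N)%N)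
  (lo hi : nat -> R)
  (lo_hi : forall k, (1 <= k <= N)%N -> [/\ a <= lo k, lo k < hi k & hi k <= b])
  (eta : R) (eta0 : 0 < eta)
  (act_pos : forall k j x, (1 <= k <= N)%N -> (1 <= j <= k)%N -> (j <= H)%N ->
    act j -> lo k <= x <= hi k -> eta <= preact t0 j x)
  (act_neg : forall k j x, (1 <= k <= N)%N -> (k < j <= H)%N ->
    act j -> lo k <= x <= hi k -> preact t0 j x <= - eta)
  (inact_neg : forall j x, (1 <= j <= H)%N -> ~~ act j -> I x ->
    preact t0 j x <= - eta)
  (first_pos : forall x, I x -> eta <= preact t0 1 x)
  (kappa : R) (kappa0 : 0 <= kappa)
  (transv : forall j e, (1 <= j <= H)%N -> 0 <= e ->
    wint a b p (fun x => (`|preact t0 j x| <= e)%R%:R) <= kappa * e).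

Let wt t j := coord t j.
Let bt t j := coord t (H + j)%N.
Let vt t j := coord t (2 * H + j)%N.
Let ct t := coord t (3 * H).+1.

(* The errors of the coefficients of [v_j (w_j x + b_j)]; the error of the
   output bias is attributed to the first neuron, which is active everywhere. *)
Definition slope_error t j : R :=
  if act j then vt t j * wt t j - vt t0 j * wt t0 j else 0.

Definition bias_error t j : R :=
  if act j then vt t j * bt t j - vt t0 j * bt t0 j +
    (if j == 1%N then ct t - ct t0 else 0) else 0.

Definition coef_error t : R :=
  \sum_(1 <= j < H.+1) (`|slope_error t j| + `|bias_error t j|).

(** The steps are taken at [t] and not at [t0], so that this function is exactly a directional
    derivative of the network at [t]. *)
Definition aligned_error t x : R :=
  \sum_(1 <= j < H.+1) (slope_error t j * x + bias_error t j) * step (preact t j x).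

(** Only inner weights and biases move; dividing by the outer weight cancels the factor that the
    tangent puts in front of each neuron. *)
Definition descent_direction t : Theta :=
  param H (fun j => slope_error t j / vt t j) (fun j => bias_error t j / vt t j)
    (fun=> 0) 0.

Let P := slope_error.
Let Q := bias_error.
Let M := coef_error.
Let g := aligned_error.

Lemma coef_error_ge0 t : 0 <= M t.
Proof. by apply: sumr_ge0 => j _; rewrite addr_ge0. Qed.

Lemma le_coef_error t j : (1 <= j <= H)%N -> `|P t j| + `|Q t j| <= M t.
Proof.
move=> jH; rewrite /M /coef_error.
rewrite (bigD1_seq j) ?mem_index_iota ?iota_uniq//=.
by rewrite lerDl sumr_ge0// => i _; rewrite addr_ge0.
Qed.

Lemma affine_coef_error t j x : I x -> `|P t j * x + Q t j| <= (`|P t j| + `|Q t j|) * Y.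
Proof.
move=> Ix; rewrite (le_trans (ler_normD _ _))// normrM mulrDl lerD//.
  by rewrite ler_wpM2l// (le_trans _ (xY Ix))// lerDr.
by rewrite ler_peMr.
Qed.

Lemma aligned_error_bound t x : I x -> `|g t x| <= M t * Y.
Proof.
move=> Ix; rewrite /g /aligned_error (le_trans (ler_norm_sum _ _ _))//.
rewrite mulr_suml; apply: ler_sum => j _.
rewrite normrM (le_trans _ (@affine_coef_error t j x Ix))// ler_piMr//.
by rewrite /step; case: (0 < _); rewrite ?normr1 ?normr0.
Qed.

Lemma bounded_measurable_aligned_error t : bounded_measurable a b (g t).
Proof.
apply: bounded_measurable_sum => j; apply: bounded_measurableM.
  apply: bounded_measurableD; last exact: bounded_measurable_cst.
  by apply: bounded_measurableZ; exact: bounded_measurable_id.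
by apply: bounded_measurable_step; exact: continuous_preact.
Qed.

Section near.
Context (rho : R) (rho_nu : rho <= nu) (rho_eta : rho * Y < eta).
Context (t : Theta) (t_near : `|t - t0| <= rho).

Let preact_near j x : I x -> `|preact t j x - preact t0 j x| <= rho * Y.
Proof.
move=> Ix; rewrite -preactB (le_trans (preact_norm _ _ _))//.
by rewrite ler_pM ?addr_ge0// xY.
Qed.

Let v_near j : (1 <= j <= H)%N -> nu <= `|vt t j| /\ 0 < vt t j * vt t0 j.
Proof.
move=> jH; have := v_nu jH.
have : `|vt t j - vt t0 j| <= nu.
  by rewrite /vt -coordB (le_trans (coord_norm _ _))// (le_trans t_near).
rewrite /vt ler_norml; set v := coord t _; set v0 := coord t0 _ => /andP[h1 h2].
move: (nu0); case: (ler0P v0) => h3 nup h4; last first.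
  rewrite ger0_norm; last by lra.
  split; first by lra.
  by apply: mulr_gt0; lra.
rewrite ler0_norm; last by lra.
split; first by lra.
by rewrite -mulrNN; apply: mulr_gt0; lra.
Qed.

Let step_pos j x : I x -> eta <= preact t0 j x ->
  step (preact t j x) = 1 /\ step (preact t0 j x) = 1.
Proof.
move=> Ix h; have := preact_near j Ix; rewrite ler_norml => /andP[h1 h2].
move: h1 h2 rho_eta; set r := rho * Y => h1 h2 h3.
rewrite /step (_ : 0 < preact t j x); last by lra.
by rewrite (_ : 0 < preact t0 j x); last lra.
Qed.

Let step_neg j x : I x -> preact t0 j x <= - eta ->
  step (preact t j x) = 0 /\ step (preact t0 j x) = 0.
Proof.
move=> Ix h; have := preact_near j Ix; rewrite ler_norml => /andP[h1 h2].
move: h1 h2 rho_eta; set r := rho * Y => h1 h2 h3.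
rewrite /step ltNge (_ : preact t j x <= 0); last by lra.
by rewrite ltNge (_ : preact t0 j x <= 0); last lra.
Qed.

(** Each neuron is compared separately. Where its sign is the same at [t] and [t0] there is no
    discrepancy; where it differs, the preactivation at [t0] is at most the perturbation [rho * Y],
    and the discrepancy is at most the affine error of that neuron. *)
Lemma aligned_error_close x : I x ->
  `|realization relu t x - f x - g t x| <=
  \sum_(1 <= j < H.+1) M t * Y * (`|preact t0 j x| <= rho * Y)%R%:R.
Proof.
move=> Ix; rewrite f_t0//.
have -> : realization relu t x - realization relu t0 x - g t x =
  \sum_(1 <= j < H.+1) (vt t j * relu (preact t j x) - vt t0 j * relu (preact t0 j x)
   + (if j == 1%N then ct t - ct t0 else 0)
   - (P t j * x + Q t j) * step (preact t j x)).
  have -> : realization relu t x - realization relu t0 x = ct t - ct t0 +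
    \sum_(1 <= j < H.+1) (vt t j * relu (preact t j x) - vt t0 j * relu (preact t0 j x)).
    by rewrite sumrB /realization /vt /ct /preact; ring.
  (* The offset error becomes part of the summand of neuron 1, as in [bias_error]. *)
  have dcE : ct t - ct t0 = \sum_(1 <= j < H.+1) (if j == 1%N then ct t - ct t0 else 0).
    rewrite big_ltn//= big_nat big1 ?addr0// => j /andP[j2 _].
    by case: eqP j2 => // ->.
  rewrite [X in X + _ - _]dcE /g /aligned_error -big_split -sumrB.
  by apply: eq_bigr => j _ /=; rewrite /P /Q; ring.
rewrite (le_trans (ler_norm_sum _ _ _))// [leLHS]big_nat [leRHS]big_nat.
apply: ler_sum => j; rewrite ltnS => jH.
have RHS0 : 0 <= M t * Y * (`|preact t0 j x| <= rho * Y)%R%:R.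
  by rewrite !mulr_ge0// coef_error_ge0.
rewrite !reluE.
case: (boolP (act j)) => [aj|/[dup] naj aj]; last first.
  have [-> ->] := step_neg Ix (inact_neg jH aj Ix).
  have -> : (j == 1%N) = false by apply/negbTE; apply: contraNneq aj => ->.
  by rewrite !mulr0 !subr0 addr0 normr0.
have [j1|j1] := eqVneq j 1%N.
  subst j; have [-> ->] := step_pos Ix (first_pos Ix).
  rewrite (_ : _ - _ = 0) ?normr0//.
  rewrite /P /Q /slope_error /bias_error aj /preact /vt /bt /wt eqxx; ring.
have PQE : P t j * x + Q t j =
    vt t j * preact t j x - vt t0 j * preact t0 j x.
  rewrite /P /Q /slope_error /bias_error aj (negbTE j1) /preact /vt /bt /wt; ring.
rewrite addr0 PQE.
set z := preact t j x; set z0 := preact t0 j x.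
have [->|zz] := eqVneq (step z) (step z0); first by rewrite (_ : _ - _ = 0) ?normr0//; ring.
have [_ vv] := v_near jH.
have PQM : `|vt t j * z - vt t0 j * z0| <= M t * Y.
  by rewrite -PQE (le_trans (affine_coef_error _ _ Ix))// ler_wpM2r// le_coef_error.
have zz0 : z * z0 <= 0.
  move: zz; rewrite /step; case: (ltP 0 z) => h1; case: (ltP 0 z0) => h2; rewrite ?eqxx// => _.
    by rewrite mulr_ge0_le0// ltW.
  by rewrite mulr_le0_ge0// ltW.
have -> : `|z0| <= rho * Y.
  rewrite (le_trans _ (preact_near j Ix))// opposite_sign_norm_le// mulrC//.
rewrite mulr1 (le_trans _ PQM)//.
(* With different steps the discrepancy is [v0 z0] up to sign. Outer weights keep their sign, so
   [v z] and [v0 z0] have opposite signs and [|v0 z0|] is at most [|v z - v0 z0|]. *)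
rewrite (_ : _ - _ = vt t0 j * z0 * (step z - step z0)); last by ring.
rewrite normrM; apply: (@le_trans _ _ `|vt t0 j * z0|).
  rewrite ler_piMr// /step; case: (0 < z); case: (0 < z0);
  by rewrite ?subrr ?subr0 ?sub0r ?normrN ?normr1 ?normr0.
apply: opposite_sign_norm_le.
rewrite (_ : _ * _ = (vt t j * vt t0 j) * (z * z0)); last by ring.
by rewrite mulr_ge0_le0// ltW.
Qed.

Lemma descent_direction_norm : `|descent_direction t| <= M t / nu.
Proof.
have M0 : 0 <= M t by exact: coef_error_ge0.
have bnd j u : (1 <= j <= H)%N -> `|u| <= M t -> `|u / vt t j| <= M t / nu.
  move=> jH uM; have [vn _] := v_near jH.
  rewrite normrM normfV ler_pM ?invr_ge0// lef_pV2// posrE.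
  exact: lt_le_trans vn.
have Mnu : 0 <= M t / nu by rewrite divr_ge0// ltW.
apply: param_norm => [//||j jH]; first by rewrite normr0.
have MPQ := le_coef_error t jH.
split; last by rewrite normr0.
  by apply: bnd => //; rewrite (le_trans _ MPQ)// lerDl.
by apply: bnd => //; rewrite (le_trans _ MPQ)// lerDr.
Qed.

Lemma tangent_descent_direction x :
  tangent relu step t (descent_direction t) x = g t x.
Proof.
rewrite /tangent param_offset add0r /g /aligned_error big_nat [RHS]big_nat.
apply: eq_bigr => j; rewrite ltnS => jH; have [vn _] := v_near jH.
have v0 : vt t j != 0 by rewrite -normr_gt0 (lt_le_trans nu0).
rewrite /descent_direction param_outer// mul0r add0r.
rewrite [X in _ * (_ * X)]/preact (param_weight _ _ _ _ jH) (param_bias _ _ _ _ jH).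
by move: v0; rewrite /vt => v0; field.
Qed.

(** The margin fixes every relevant step on this piece: active neurons up to [k] are on and all
    neurons after [k] are off. Inactive neurons up to [k] have zero coefficients. *)
Lemma aligned_error_piece k x : (1 <= k <= N)%N -> (k <= H)%N -> lo k <= x <= hi k ->
  g t x = (\sum_(1 <= j < k.+1) P t j) * x + \sum_(1 <= j < k.+1) Q t j.
Proof.
move=> kN kH xk.
have Ix : I x.
  have [ak _ kb] := lo_hi kN; move: xk => /andP[kx xk].
  by rewrite /= in_itv/= (le_trans ak kx) (le_trans xk kb).
rewrite /g /aligned_error (big_cat_nat (n := k.+1))//=.
rewrite [X in _ + X]big_nat [X in _ + X]big1 ?addr0; last first.
  move=> j jk; have [aj|aj] := boolP (act j).
    by have [-> _] := step_neg Ix (act_neg kN jk aj xk); rewrite mulr0.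
  have jH : (1 <= j <= H)%N.
    by move: jk => /andP[kj jH]; rewrite (leq_ltn_trans _ kj).
  by have [-> _] := step_neg Ix (inact_neg jH aj Ix); rewrite mulr0.
rewrite mulr_suml -big_split/= big_nat [RHS]big_nat; apply: eq_bigr => j jk.
have [aj|aj] := boolP (act j).
  have jH : (j <= H)%N by move: jk => /andP[_ jk]; exact: leq_trans kH.
  by have [-> _] := step_pos Ix (act_pos kN jk jH aj xk); rewrite mulr1.
by rewrite /P /Q /slope_error /bias_error (negbTE aj) mul0r addr0 mul0r.
Qed.

End near.

Context (NH : (N <= H)%N).

(** The integral controls the partial sums of the coefficient errors on each piece, and differences
    over consecutive pieces recover the single errors. *)
Lemma aligned_error_ge : exists2 c0 : R, 0 < c0 & forall rho t,
  rho <= nu -> rho * Y < eta -> `|t - t0| <= rho ->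
  c0 * M t ^+ 2 <= wint a b p (fun x => g t x ^+ 2).
Proof.
pose W al be k := wint a b p (fun x => (al * x + be) ^+ 2 * (lo k <= x <= hi k)%R%:R).
have [||c1 c10 hc1] := @uniform_lower_constant R N (fun k c => (1 <= k)%N ->
    forall al be : R, c * (`|al| + `|be|) ^+ 2 <= W al be k).
- move=> k c1 c2 h c21 k1 al be; apply: le_trans (h k1 al be).
  by rewrite ler_wpM2r ?sqr_ge0.
- move=> k kN; have [k0|k0] := posnP k; first by exists 1 => //; rewrite k0.
  have [|ak kk kb] := lo_hi (k := k); first by rewrite k0.
  have [c1 c10 h] := wint_affine_ge bp c_gt0 cp ak kk kb.
  by exists c1 => // _; exact: h.
have H1 : 0 < H%:R :> R by rewrite ltr0n.
(* Each partial sum is at most [S], each of the [H] single errors at most [2 * S], hence the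
   coefficient error is at most [H * 2 * S]. *)
exists (c1 / (H%:R * 2) ^+ 2); first by rewrite divr_gt0// exprn_gt0 ?mulr_gt0.
move=> rho t r1 r2 tr.
have g20 : 0 <= wint a b p (fun x => g t x ^+ 2).
  by apply: wint_ge0 => // x _; exact: sqr_ge0.
pose S := Num.sqrt (wint a b p (fun x => g t x ^+ 2) / c1).
pose A k := \sum_(1 <= j < k.+1) P t j.
pose B k := \sum_(1 <= j < k.+1) Q t j.
have AB k : (k <= N)%N -> `|A k| + `|B k| <= S.
  move=> kN; have [k0|k0] := posnP k.
    by rewrite /A /B k0 !big_geq// normr0 addr0 sqrtr_ge0.
  rewrite -[leLHS]ger0_norm ?addr_ge0// -sqrtr_sqr ler_wsqrtr//.
  rewrite ler_pdivlMr// mulrC (le_trans (hc1 k kN k0 _ _))//.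
  have bA : bounded_measurable a b (fun x => A k * x + B k).
    apply: bounded_measurableD; last exact: bounded_measurable_cst.
    by apply: bounded_measurableZ; exact: bounded_measurable_id.
  apply: wint_le => //.
  - apply: bounded_measurableM; last exact: bounded_measurable_itv.
    exact: bounded_measurable_sqr.
  - by apply: bounded_measurable_sqr; exact: bounded_measurable_aligned_error.
  move=> x Ix; case: (boolP (lo k <= x <= hi k)) => [xk|_]; last first.
    by rewrite mulr0 sqr_ge0.
  have k1N : (1 <= k <= N)%N by rewrite k0.
  by rewrite mulr1 (aligned_error_piece r2 tr k1N (leq_trans kN NH) xk).
have S0 : 0 <= S by exact: sqrtr_ge0.
have PQ j : (1 <= j <= H)%N -> `|P t j| + `|Q t j| <= 2 * S.
  move=> jH; have [jN|jN] := leqP j N; last first.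
    have naj : act j = false.
      by apply/negbTE/negP => aj; have := act_le jH aj; rewrite leqNgt jN.
    by rewrite /P /Q /slope_error /bias_error naj normr0 addr0 mulr_ge0.
  case: j jH jN => // j _ jN.
  have PE : P t j.+1 = A j.+1 - A j.
    by rewrite /A [\sum_(1 <= _ < j.+2) _]big_nat_recr//= addrAC subrr add0r.
  have QE : Q t j.+1 = B j.+1 - B j.
    by rewrite /B [\sum_(1 <= _ < j.+2) _]big_nat_recr//= addrAC subrr add0r.
  rewrite PE QE.
  have := AB j.+1 jN; have := AB j (ltnW jN).
  have := ler_normB (A j.+1) (A j); have := ler_normB (B j.+1) (B j).
  by move=> h1 h2 h3 h4; lra.
have MS : M t <= H%:R * 2 * S.
  rewrite -mulrA; apply: (le_trans (ler_norm _)); apply: ler_norm_sum_nat => j jH.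
  by rewrite ger0_norm ?addr_ge0// PQ.
rewrite mulrAC ler_pdivrMr ?exprn_gt0 ?mulr_gt0//.
have S2 : c1 * S ^+ 2 = wint a b p (fun x => g t x ^+ 2).
  by rewrite sqr_sqrtr ?divr_ge0 ?(ltW c10)// mulrC divfK// gt_eqF.
rewrite -S2 -mulrA ler_wpM2l ?(ltW c10)// mulrC -exprMn.
by rewrite lerXn2r ?nnegrE ?mulr_ge0// coef_error_ge0.
Qed.

Lemma lojasiewicz : exists2 rho : R, 0 < rho & exists2 m : R, 0 < m &
  forall t, `|t - t0| <= rho ->
    m * risk a b f p relu t <= `|risk_gradient a b f p relu step t| ^+ 2.
Proof.
have [c0 c00 hc0] := aligned_error_ge.
have Ygt0 : 0 < Y by exact: lt_le_trans Y1.
pose Z := Y * (Y * (H%:R * (kappa * Y))).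
have Z0 : 0 <= Z by rewrite !mulr_ge0.
(* The three terms preserve the outer weights, preserve the signs on the pieces, and make the strips
   so thin that the discrepancy costs at most half of the lower bound [2 * c0 * M t ^+ 2]. *)
pose rho := Num.min nu (Num.min (eta / (2 * Y)) (c0 / (2 * (Z + 1)))).
have rho0 : 0 < rho.
  by rewrite !lt_min nu0 !divr_gt0 ?mulr_gt0// ltr_wpDl.
have rho_nu : rho <= nu by rewrite ge_min lexx.
have rho_eta : rho * Y < eta.
  apply: (@le_lt_trans _ _ (eta / (2 * Y) * Y)).
    by rewrite ler_wpM2r// !ge_min lexx orbT.
  by rewrite invfM mulrA divfK ?gt_eqF// ltr_pdivrMr// mulr2n mulrDr mulr1 ltrDl.
have rho_Z : 2 * (Z * rho) <= c0.
  have h : rho <= c0 / (2 * (Z + 1)) by rewrite !ge_min lexx !orbT.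
  move: h; rewrite ler_pdivlMr ?mulr_gt0 ?ltr_wpDl// => h.
  apply: le_trans h; rewrite mulrDr mulr1 mulrDr [leLHS]mulrA [leLHS]mulrC lerDl.
  by rewrite mulr_ge0 ?(ltW rho0).
exists rho => //.
(* The scalar product is bounded by the number of coordinates times the sup norms, and the direction
   has norm at most [M t / nu]. *)
pose D := (3 * H).+1%:R / nu : R.
have D0 : 0 < D by rewrite divr_gt0.
pose Pw := wint a b p (fun=> 1) + 1.
have Pw0 : 0 < Pw by rewrite ltr_wpDl//; exact: wint_ge0.
pose C := Y + H%:R * Y.
have C0 : 0 < C by rewrite ltr_pwDl// mulr_ge0.
exists ((c0 / D) ^+ 2 / (C ^+ 2 * Pw)).
  apply: divr_gt0; first by apply: exprn_gt0; exact: divr_gt0.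
  by apply: mulr_gt0 => //; exact: exprn_gt0.
move=> t tr; set G := risk_gradient _ _ _ _ _ _ t.
have M0 := coef_error_ge0 t.
pose e x := realization relu t x - f x.
have be : bounded_measurable a b e.
  apply: bounded_measurableB => //; apply: bounded_measurable_realization.
  exact: continuous_relu.
have bg := bounded_measurable_aligned_error t.
pose Sr x := \sum_(1 <= j < H.+1) M t * Y * (`|preact t0 j x| <= rho * Y)%R%:R.
have bS : bounded_measurable a b Sr.
  apply: bounded_measurable_sum => j; apply: bounded_measurableZ.
  exact: bounded_measurable_small.
have eg x : I x -> `|e x - g t x| <= Sr x by apply: aligned_error_close.
have intS : wint a b p Sr <= H%:R * (M t * Y * (kappa * (rho * Y))).
  rewrite wint_sum//; last first.
    by move=> j; apply: bounded_measurableZ; exact: bounded_measurable_small.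
  apply: (le_trans (ler_norm _)); apply: ler_norm_sum_nat => j jH.
  rewrite wintZ//; last exact: bounded_measurable_small.
  rewrite ger0_norm; last by rewrite !mulr_ge0//; exact: wint_ge0.
  by rewrite ler_wpM2l ?mulr_ge0// transv// mulr_ge0// ltW.
have eg_ge : c0 * M t ^+ 2 <= wint a b p (fun x => 2 * e x * g t x).
  have h1 : 2 * wint a b p (fun x => g t x ^+ 2) - 2 * (M t * Y) * wint a b p Sr
      <= wint a b p (fun x => 2 * e x * g t x).
    rewrite -mulNr -(wintZ bp 2); last exact: bounded_measurable_sqr.
    have bg2 : bounded_measurable a b (fun x => 2 * g t x ^+ 2).
      by apply: bounded_measurableZ; exact: bounded_measurable_sqr.
    rewrite -(wintZ bp (- _)) // -wintD //; last exact: bounded_measurableZ.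
    apply: wint_le => //.
    - apply: bounded_measurableD; last exact: bounded_measurableZ.
      by apply: bounded_measurableZ; exact: bounded_measurable_sqr.
    - by apply: bounded_measurableM => //; exact: bounded_measurableZ.
    move=> x Ix.
    have h2 : `|(e x - g t x) * g t x| <= Sr x * (M t * Y).
      by rewrite normrM ler_pM// ?eg// aligned_error_bound.
    have h3 : - ((e x - g t x) * g t x) <= Sr x * (M t * Y).
      by rewrite (le_trans _ h2)// -normrN ler_norm.
    rewrite (_ : 2 * e x * g t x = 2 * g t x ^+ 2 + 2 * ((e x - g t x) * g t x)); last by ring.
    rewrite lerD2l; move: h3; set u := _ * g t x; set m := M t * Y => h3.
    rewrite mulNr -[2 * m * _]mulrA -mulrN ler_wpM2l//.
    by rewrite lerNl [m * _]mulrC.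
  apply: le_trans h1.
  have h2 := hc0 _ _ rho_nu rho_eta tr.
  have h3 : 2 * (M t * Y) * wint a b p Sr <= c0 * M t ^+ 2.
    apply: (@le_trans _ _ (2 * (M t * Y) * (H%:R * (M t * Y * (kappa * (rho * Y)))))).
      by rewrite ler_wpM2l ?mulr_ge0.
    rewrite (_ : 2 * _ * _ = 2 * (Z * rho) * M t ^+ 2); last by rewrite /Z; ring.
    by rewrite ler_wpM2r ?sqr_ge0.
  by move: h2 h3; lra.
(* Testing the gradient against [descent_direction t] gives the integral of [2 * e * g]. A factor
   [M t] is cancelled, so its vanishing is treated first. *)
have MG : c0 / D * M t <= `|G|.
  have [->|Mn0] := eqVneq (M t) 0; first by rewrite mulr0.
  have Mgt0 : 0 < M t by rewrite lt_neqAle eq_sym Mn0.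
  rewrite mulrAC ler_pdivrMr// -(ler_pM2r Mgt0) -mulrA -expr2.
  apply: (le_trans eg_ge).
  have -> : wint a b p (fun x => 2 * e x * g t x) =
      \sum_i G ord0 i * descent_direction t ord0 i.
    rewrite risk_gradient_dot//; apply: eq_wint => x Ix.
    by rewrite (tangent_descent_direction rho_nu tr).
  apply: (le_trans (ler_norm _)); apply: (le_trans (ler_norm_sum _ _ _)).
  apply: (@le_trans _ _ (\sum_(i < (3 * H).+1) `|G| * (M t / nu))).
    apply: ler_sum => i _; rewrite normrM ler_pM ?rV_norm_ge//.
    rewrite (le_trans (rV_norm_ge _ _))//.
    exact: (descent_direction_norm rho_nu tr).
  rewrite sumr_const card_ord -[leLHS]mulr_natl /D.
  by rewrite le_eqVlt; apply/orP; left; apply/eqP; ring.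
have riskM : risk a b f p relu t <= (C * M t) ^+ 2 * Pw.
  rewrite riskE; apply: (@le_trans _ _ ((C * M t) ^+ 2 * wint a b p (fun=> 1))); last first.
    by rewrite ler_wpM2l ?sqr_ge0// lerDl.
  rewrite -wintZ//; last exact: bounded_measurable_cst.
  apply: wint_le => //; first exact: bounded_measurable_sqr.
    by apply: bounded_measurableZ; exact: bounded_measurable_cst.
  move=> x Ix; rewrite mulr1 -/(e x) -[leLHS]real_normK ?num_real//.
  rewrite lerXn2r ?nnegrE ?mulr_ge0 ?(ltW C0)//.
  rewrite -(subrK (g t x) (e x)) (le_trans (ler_normD _ _))// addrC.
  rewrite /C mulrDl; apply: lerD; first by rewrite mulrC; exact: aligned_error_bound.
  rewrite (le_trans (eg _ Ix))// -mulrA; apply: (le_trans (ler_norm _)).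
  apply: ler_norm_sum_nat => j _; rewrite ger0_norm ?mulr_ge0// [Y * _]mulrC.
  by rewrite ler_piMr ?mulr_ge0// lern1 leq_b1.
apply: (@le_trans _ _ ((c0 / D * M t) ^+ 2)); last first.
  have cD0 : 0 <= c0 / D by rewrite divr_ge0// ltW.
  by rewrite lerXn2r// ?nnegrE// mulr_ge0.
have m0 : 0 <= (c0 / D) ^+ 2 / (C ^+ 2 * Pw).
  by rewrite divr_ge0 ?sqr_ge0// mulr_ge0 ?sqr_ge0// ltW.
apply: (le_trans (ler_wpM2l m0 riskM)).
rewrite le_eqVlt; apply/orP; left; apply/eqP.
have Cn0 : C != 0 by rewrite gt_eqF.
have Pn0 : Pw != 0 by rewrite gt_eqF.
have Dn0 : D != 0 by rewrite gt_eqF.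
by move: (C) (Pw) (D) Cn0 Pn0 Dn0 => C' P' D' Cn0 Pn0 Dn0; field; rewrite Cn0 Pn0 Dn0.
Qed.

End lojasiewicz.

(** * Gradient descent under a Lojasiewicz inequality *)

Section gradient_descent.
Context {R : realType} {V : normedModType R}.
Implicit Types (L : V -> R) (G : V -> V) (theta : nat -> V).

(* With [x = sqrt (L t)] and [y = sqrt (L t')] for consecutive iterates, the
   step length is bounded by the telescoping difference [x - y]. *)
Lemma step_length_bound (m gamma g x y : R) : 0 < m -> 0 < gamma -> 0 <= g ->
  0 <= x -> 0 <= y -> m ^+ 2 * x ^+ 2 <= g ^+ 2 ->
  y ^+ 2 <= x ^+ 2 - gamma / 2 * g ^+ 2 ->
  gamma * g <= 4 / m * (x - y).
Proof.
move=> m0 gamma0 g0 x0 y0 PL dec.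
have gg : 0 <= gamma / 2 * g ^+ 2 by rewrite mulr_ge0 ?sqr_ge0// divr_ge0// ltW.
have yx : y <= x by rewrite -ler_sqr ?nnegrE//; lra.
have mxg : m * x <= g by rewrite -ler_sqr ?nnegrE ?mulr_ge0 ?(ltW m0)// exprMn.
rewrite mulrAC ler_pdivlMr//.
(* If [x] is 0, the decrease forces [g] to be 0; otherwise the claim may be multiplied by [x], and
   [gamma * g * m * x <= gamma * g^2 <= 2 * (x - y) * (x + y) <= 4 * x * (x - y)]. *)
have [x00|xn0] := eqVneq x 0.
  have y00 : y = 0 by apply/eqP; rewrite eq_le y0 -x00 yx.
  have g00 : gamma / 2 * g ^+ 2 <= 0.
    by move: dec; rewrite x00 y00 expr0n/= sub0r => dec; lra.
  have g2 : g ^+ 2 = 0.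
    apply/eqP; rewrite eq_le sqr_ge0 andbT.
    by rewrite -(@pmulr_rle0 _ (gamma / 2))// divr_gt0.
  have -> : g = 0 by apply/eqP; rewrite -sqrf_eq0 g2.
  by rewrite mulr0 mul0r x00 y00 subrr mulr0.
have xgt0 : 0 < x by rewrite lt_neqAle eq_sym xn0.
rewrite -(ler_pM2r xgt0).
have h1 : gamma / 2 * g ^+ 2 <= (x - y) * (x + y).
  by rewrite (_ : (x - y) * (x + y) = x ^+ 2 - y ^+ 2); [lra|ring].
have h2 : (x - y) * (x + y) <= (x - y) * (2 * x).
  by rewrite ler_wpM2l ?subr_ge0//; lra.
have h3 : gamma / 2 * (g * (m * x)) <= gamma / 2 * g ^+ 2.
  by rewrite expr2 ler_wpM2l ?divr_ge0 ?(ltW gamma0)// ler_wpM2l.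
rewrite (_ : gamma * g * m * x = 2 * (gamma / 2 * (g * (m * x)))); last by field.
rewrite (_ : 4 * (x - y) * x = 2 * ((x - y) * (2 * x))); last by ring.
by rewrite ler_wpM2l//; lra.
Qed.

(** The quantity [|theta n - t0| + 4 / m * sqrt (L (theta n))] does not increase while the iterates
    stay in the ball, and it starts below [rho]; hence they never leave and the linear rate
    persists. *)
Lemma gradient_descent_converges L G (t0 : V) (rho m K B : R) :
  0 < rho -> 0 < m -> 0 <= K -> 0 <= B ->
  (forall t, 0 <= L t) -> L t0 = 0 ->
  (forall e, 0 < e -> exists2 d : R, 0 < d & forall t, `|t - t0| <= d -> L t <= e) ->
  (forall t, `|t - t0| <= rho -> m ^+ 2 * L t <= `|G t| ^+ 2) ->
  (forall t, `|t - t0| <= rho -> `|G t| <= B) ->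
  (forall t gamma, `|t - t0| <= rho -> 0 < gamma -> gamma * `|G t| <= 1 ->
    L (t - gamma *: G t) <=
      L t - gamma * `|G t| ^+ 2 + K * (gamma * `|G t|) ^+ 2) ->
  exists c d : R, [/\ 0 < c, 0 < d & forall gamma theta,
    0 < gamma <= c -> `|theta 0%N - t0| <= d ->
    (forall n, theta n.+1 = theta n - gamma *: G (theta n)) ->
    forall n, L (theta n) <= expR (- c * gamma * n%:R)].
Proof.
move=> rho0 m0 K0 B0 L0 Lt0 Lcont PL GB descent.
pose ka := 4 / m; have ka0 : 0 < ka by rewrite divr_gt0.
(* The second term makes [ka * sqrt (L (theta 0))] at most [rho / 2]; the first lets the final bound
   have prefactor 1. *)
pose e := Num.min 1 ((rho / (2 * ka)) ^+ 2).
have e0 : 0 < e by rewrite lt_min ltr01 exprn_gt0// divr_gt0// mulr_gt0.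
have [d d0 dL] := Lcont e e0.
(* In order: the contraction rate, the condition [K * gamma <= 1 / 2] absorbing the quadratic term,
   and a step length of at most 1. *)
pose c := Num.min (m ^+ 2 / 2) (Num.min (1 / (2 * K + 1)) (1 / (B + 1))).
have c0 : 0 < c.
  by rewrite !lt_min !divr_gt0 ?exprn_gt0// ltr_wpDl// mulr_ge0.
have c1 : c <= m ^+ 2 / 2 by rewrite ge_min lexx.
have c2 : c <= 1 / (2 * K + 1) by rewrite !ge_min lexx !orbT.
have c3 : c <= 1 / (B + 1) by rewrite !ge_min lexx !orbT.
exists c, (Num.min d (rho / 2)); split=> //.
  by rewrite lt_min d0 divr_gt0.
move=> gamma theta /andP[gamma0 gammac]; rewrite le_min => /andP[th0d th0r] thS.
have L00 : L (theta 0%N) <= e by exact: dL.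
have step t : `|t - t0| <= rho ->
    L (t - gamma *: G t) <= L t - gamma / 2 * `|G t| ^+ 2.
  move=> tr; have gB := GB _ tr.
  have g1 : gamma * `|G t| <= 1.
    have h : gamma <= 1 / (B + 1) by exact: le_trans c3.
    have B1 : 0 < B + 1 by rewrite ltr_wpDl.
    move: h; rewrite ler_pdivlMr// => h.
    apply: le_trans h; rewrite ler_wpM2l ?(ltW gamma0)//.
    by rewrite (le_trans gB)// lerDl.
  apply: (le_trans (descent _ _ tr gamma0 g1)).
  have h : gamma * (2 * K + 1) <= 1.
    by rewrite -ler_pdivlMr ?ltr_wpDl ?mulr_ge0//; exact: le_trans c2.
  have gK : K * gamma <= 2^-1 by lra.
  rewrite -addrA lerD2l exprMn.
  rewrite (_ : K * (gamma ^+ 2 * `|G t| ^+ 2) =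
    (K * gamma) * (gamma * `|G t| ^+ 2)); last by ring.
  have := ler_wpM2r (mulr_ge0 (ltW gamma0) (sqr_ge0 `|G t|)) gK.
  by lra.
pose s n := Num.sqrt (L (theta n)).
have inv n : `|theta n - t0| + ka * s n <= `|theta 0%N - t0| + ka * s 0%N /\
    L (theta n) <= e * expR (- c * gamma * n%:R).
  elim: n => [|n [IH1 IH2]]; first by rewrite mulr0 expR0 mulr1.
  have s0e : ka * s 0%N <= rho / 2.
    apply: (@le_trans _ _ (ka * Num.sqrt e)).
      by apply: ler_wpM2l; [exact: ltW|exact: ler_wsqrtr].
    apply: (@le_trans _ _ (ka * (rho / (2 * ka)))).
      apply: ler_wpM2l; first exact: ltW.
      have h : 0 <= rho / (2 * ka).
        by apply: divr_ge0; [exact: ltW|apply: mulr_ge0 => //; exact: ltW].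
      by rewrite -[leRHS]ger0_norm// -sqrtr_sqr ler_wsqrtr// /e ge_min lexx orbT.
    by rewrite le_eqVlt; apply/orP; left; apply/eqP; field; rewrite gt_eqF.
  have near : `|theta n - t0| <= rho.
    have : 0 <= ka * s n by rewrite mulr_ge0 ?(ltW ka0)// sqrtr_ge0.
    by lra.
  have dec := step _ near; rewrite -thS in dec.
  split.
    have : gamma * `|G (theta n)| <= 4 / m * (s n - s n.+1).
      apply: step_length_bound => //; try exact: sqrtr_ge0.
        by rewrite sqr_sqrtr// PL.
      by rewrite !sqr_sqrtr.
    have : `|theta n.+1 - t0| <= `|theta n - t0| + gamma * `|G (theta n)|.
      rewrite thS addrAC (le_trans (ler_normB _ _))// lerD2l normrZ.
      by rewrite gtr0_norm.
    by rewrite -/ka mulrBr; lra.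
  apply: (@le_trans _ _ (L (theta n) * expR (- c * gamma))).
    apply: (@le_trans _ _ (L (theta n) * (1 + - c * gamma))); last first.
      by rewrite ler_wpM2l// expR_ge1Dx.
    apply: (le_trans dec).
    have := ler_wpM2l (ltW gamma0) (PL _ near).
    have := ler_wpM2r (mulr_ge0 (ltW gamma0) (L0 (theta n))) c1.
    by move=> h1 h2; lra.
  rewrite -natr1 mulrDr mulr1 expRD mulrA.
  by apply: ler_wpM2r; [exact: expR_ge0|exact: IH2].
move=> n; have [_ /le_trans] := inv n; apply.
by rewrite ler_piMl ?expR_ge0// ge_min lexx.
Qed.

End gradient_descent.

(** * The global minimizer *)

(** With slope at least 1/2 the set lies within distance [2 * e] of the zero [- d / w], that is, in
    an interval of length [4 * e]. *)
Lemma wint_affine_small (R : realType) (a b : R) (p : R -> R) (C w d e : R) :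
  bounded_measurable a b p -> (forall x, `[a, b]%classic x -> 0 <= p x) ->
  0 <= C -> (forall x, `[a, b]%classic x -> p x <= C) -> 2^-1 <= w -> 0 <= e ->
  wint a b p (fun x => (`|w * x + d| <= e)%R%:R) <= 4 * C * e.
Proof.
move=> bp p0 C0 pC w2 e0; have w0 : 0 < w by lra.
apply: (@le_trans _ _ (wint a b p
    (fun x => (- d / w - 2 * e <= x <= - d / w + 2 * e)%R%:R))).
  apply: wint_le => //; last 1 first.
  - move=> x _; rewrite ler_nat; case: (lerP `|w * x + d| e) => // h.
    suff -> : - d / w - 2 * e <= x <= - d / w + 2 * e by [].
    have h1 : w * `|x + d / w| <= e.
      rewrite -[w in w * _]gtr0_norm// -normrM (_ : w * (x + d / w) = w * x + d)//.
      by field; rewrite gt_eqF.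
    have h2 : `|x + d / w| <= 2 * e.
      have := normr_ge0 (x + d / w); nra.
    by move: h2; rewrite ler_norml mulNr => /andP[? ?]; apply/andP; split; lra.
  - apply: bounded_measurable_bool; apply: measurable_fun_ler.
      apply: measurableT_comp => //.
      suff [] : bounded_measurable a b (fun x => w * x + d) by [].
      apply: bounded_measurableD; last exact: bounded_measurable_cst.
      by apply: bounded_measurableZ; exact: bounded_measurable_id.
    exact: measurable_cst.
  - exact: bounded_measurable_itv.
apply: le_trans (wint_itv_le bp C0 pC _) _; first by lra.
by rewrite le_eqVlt; apply/orP; left; apply/eqP; ring.
Qed.

Section target.
Context {R : realType} {H : nat} (N : nat) (hN : (1 <= N <= H)%N)
  (xs : nat -> R) (a b : R) (hx0 : xs 0%N = a) (hxN : xs N = b)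
  (hxs : forall i : nat, (1 <= i <= N)%N -> xs i.-1 < xs i)
  (f : R -> R) (sl ic : nat -> R)
  (hf : forall i, (1 <= i <= N)%N -> forall x, xs i.-1 <= x <= xs i ->
    f x = sl i * x + ic i).
Local Notation I := (`[a, b]%classic : set R).
Let Y : R := 1 + `|a| + `|b|.

Lemma knots_monotone i j : (i <= j <= N)%N -> xs i <= xs j.
Proof.
move=> /andP[]; elim: j => [|j IH]; first by rewrite leqn0 => /eqP ->.
rewrite leq_eqVlt => /predU1P[->//|]; rewrite ltnS => ij jN.
by rewrite (le_trans (IH ij (ltnW jN)))// ltW// (hxs (i := j.+1)).
Qed.

Lemma knot_piece x : I x -> exists2 k, (1 <= k <= N)%N & xs k.-1 <= x <= xs k.
Proof.
rewrite /= in_itv/= -hx0 -hxN => /andP[x0].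
suff h n : (1 <= n <= N)%N -> x <= xs n ->
    exists2 k, (1 <= k <= N)%N & xs k.-1 <= x <= xs k.
  by apply: h; move: hN => /andP[-> _] /=.
elim: n => // n IH nN xn; have [xn'|xn'] := leP x (xs n); last first.
  by exists n.+1 => //=; rewrite ltW.
case: n => [|n] in IH nN xn xn' *.
  by exists 1%N => //=; rewrite x0.
by apply: IH => //; move: nN => /andP[_ /ltnW].
Qed.

(** Index [j] stands for the knot [xs j.-1] between pieces [j.-1] and [j]; counting starts at 2
    because the knot [xs 0] is the endpoint [a]. *)
Definition kink j := (2 <= j <= N)%N && (sl j != sl j.-1).

(* The first neuron is active on all of [a, b] and carries the affine part of
   the first piece; the neuron [j >= 2] has its kink at [xs j.-1], unless the
   slope does not change there, in which case it is inactive on [a, b]. *)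
Definition target_weight j : R :=
  if j == 1%N then sl 1 else if kink j then 1 else 0.
Definition target_bias j : R :=
  if j == 1%N then 1 + `|sl 1| * Y else if kink j then - xs j.-1 else -1.
Definition target_outer j : R := if kink j then sl j - sl j.-1 else 1.

(** The offset cancels the shift [1 + |sl 1| * Y] in the bias of the first neuron, which keeps its
    preactivation at least 1 on [a, b]. *)
Definition target : 'rV[R]_(3 * H).+1 :=
  param H target_weight target_bias target_outer (ic 1 - (1 + `|sl 1| * Y)).

Definition active j := (j == 1%N) || kink j.

Lemma kink_neq1 j : kink j -> (j == 1%N) = false.
Proof. by move=> /andP[/andP[j2 _] _]; case: eqP j2 => // ->. Qed.

Lemma active_le j : active j -> (j <= N)%N.
Proof.
by case/orP => [/eqP ->|/andP[/andP[_]]//]; move: hN => /andP[].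
Qed.

Lemma preact_target j x : (1 <= j <= H)%N ->
  preact target j x = target_weight j * x + target_bias j.
Proof. by move=> jH; rewrite /preact param_weight// param_bias. Qed.

Lemma preact_target_first x : I x -> 1 <= preact target 1 x.
Proof.
move=> Ix; rewrite preact_target; last by move: hN => /andP[h1 h2]; rewrite (leq_trans h1 h2).
rewrite /target_weight /target_bias eqxx addrCA lerDl.
have h1 := itv_norm_bound Ix.
have h2 : `|sl 1 * x| <= `|sl 1| * Y.
  by rewrite normrM ler_wpM2l// (le_trans _ h1)// lerDr.
by move: h2; rewrite ler_norml => /andP[h2 _]; rewrite -lerBlDr sub0r.
Qed.

Lemma preact_target_kink j x : (1 <= j <= H)%N -> kink j ->
  preact target j x = x - xs j.-1.
Proof.
move=> jH kj; rewrite preact_target// /target_weight /target_bias.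
by rewrite kink_neq1// kj mul1r.
Qed.

Lemma preact_target_inactive j x : (1 <= j <= H)%N -> ~~ active j ->
  preact target j x = -1.
Proof.
move=> jH; rewrite negb_or => /andP[/negbTE j1 /negbTE kj].
by rewrite preact_target// /target_weight /target_bias j1 kj mul0r add0r.
Qed.

(** Adjacent affine pieces agree at their common knot, so crossing a knot adds the slope jump times
    the distance from it. *)
Lemma telescope_pieces k x : (1 <= k <= N)%N ->
  \sum_(2 <= j < k.+1) (sl j - sl j.-1) * (x - xs j.-1) =
  sl k * x + ic k - (sl 1 * x + ic 1).
Proof.
move=> /andP[k1]; case: k k1 => // k _.
elim: k => [|k IH] kN; first by rewrite big_geq// subrr.
rewrite big_nat_recr//= IH; last exact: ltnW.
have h1 : f (xs k.+1) = sl k.+1 * xs k.+1 + ic k.+1.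
  by apply: hf; rewrite ?(ltnW kN)//= lexx andbT (ltW (hxs (i := k.+1) _))//= ltnW.
have h2 : f (xs k.+1) = sl k.+2 * xs k.+1 + ic k.+2.
  by apply: hf; rewrite ?kN//= lexx /= (ltW (hxs (i := k.+2) _)).
have h3 : ic k.+2 = ic k.+1 - (sl k.+2 - sl k.+1) * xs k.+1.
  by move: h2; rewrite h1 => h; rewrite mulrBl; lra.
by rewrite h3; ring.
Qed.

(** On piece [k] the neurons after [k] vanish, the first gives the affine part of piece 1, and the
    rest give the telescoping sum; a neuron without kink vanishes, as does the matching slope
    jump. *)
Lemma realization_target x : I x -> f x = realization relu target x.
Proof.
move=> Ix; have [k kN xk] := knot_piece Ix; rewrite (hf kN xk).
have kH : (k <= H)%N by move: kN hN => /andP[_ h] /andP[_]; exact: leq_trans h.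
have k1 : (0 < k)%N by case/andP: kN.
rewrite /realization param_offset (big_cat_nat (n := k.+1))//=.
rewrite [X in _ + (_ + X)]big_nat [X in _ + (_ + X)]big1 ?addr0; last first.
  move=> j /andP[kj jH]; have j1H : (1 <= j <= H)%N by rewrite (leq_ltn_trans _ kj).
  rewrite -/(preact target j x); have [aj|aj] := boolP (active j); last first.
    by rewrite preact_target_inactive// /relu max_r ?mulr0.
  have kj' : kink j.
    by move: aj => /orP[/eqP j1|//]; move: kj; rewrite j1 ltnS leqNgt k1.
  rewrite preact_target_kink// /relu max_r ?mulr0// subr_le0.
  move: xk => /andP[_ xk]; rewrite (le_trans xk)// knots_monotone//.
  have jN := active_le aj.
  by case: j kj jN {j1H jH aj kj'} => // j kj /ltnW jN /=; rewrite -ltnS kj.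
rewrite big_ltn//.
rewrite -/(preact target 1 x) param_outer; last by rewrite (leq_trans k1 kH).
rewrite /target_outer {1}/kink/= mul1r.
have z1 := preact_target_first Ix; rewrite /relu max_l; last exact: le_trans z1.
rewrite preact_target; last by rewrite (leq_trans k1 kH).
rewrite /target_weight /target_bias eqxx.
have -> : \sum_(2 <= j < k.+1) coord target (2 * H + j) *
    Num.max (coord target j * x + coord target (H + j)) 0 =
  \sum_(2 <= j < k.+1) (sl j - sl j.-1) * (x - xs j.-1).
  apply: eq_big_nat => j /andP[j2 jk]; rewrite ltnS in jk.
  have j1H : (1 <= j <= H)%N by rewrite (ltnW j2) (leq_trans jk kH).
  rewrite -/(preact target j x) param_outer// /target_outer.
  have jN : (j <= N)%N by case/andP: kN => _; exact: leq_trans jk.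
  have [kj|kj] := boolP (kink j).
    rewrite preact_target_kink// max_l// subr_ge0.
    move: xk => /andP[xk _]; rewrite (le_trans _ xk)// knots_monotone//.
    move: kN => /andP[_ kN]; rewrite (leq_trans (leq_pred _) kN) andbT.
    by rewrite -!subn1 leq_sub2r.
  have j1 : (j == 1%N) = false by case: eqP j2 => // ->.
  rewrite preact_target_inactive// ?negb_or ?j1//.
  move: kj; rewrite /kink j2 jN /= negbK => /eqP ->.
  by rewrite subrr mul0r max_r ?mulr0.
by rewrite telescope_pieces//; ring.
Qed.

Context (p : R -> R) (bp : bounded_measurable a b p) (c : R) (c_gt0 : 0 < c)
  (cp : forall x, I x -> c <= p x).

Let p0 x : I x -> 0 <= p x.
Proof. by move=> /cp; apply: le_trans; exact: ltW. Qed.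

Let Y1 : 1 <= Y. Proof. by rewrite /Y -addrA lerDl addr_ge0. Qed.

(** Near the target a kink neuron has slope at least 1/2, and every other neuron has a preactivation
    bounded away from 0. *)
Lemma target_transversal : exists2 rho : R, 0 < rho & exists2 kappa : R,
  0 <= kappa & forall t j e, `|t - target| <= rho -> (1 <= j <= H)%N -> 0 <= e ->
    wint a b p (fun x => (`|preact t j x| <= e)%R%:R) <= kappa * e.
Proof.
have Y0 : 0 < Y by exact: lt_le_trans Y1.
have [_ [C pC]] := bp.
pose Pw := wint a b p (fun=> 1).
have Pw0 : 0 <= Pw by exact: wint_ge0.
(* Within this radius every coordinate and every preactivation on [a, b] moves by at most 1/2. *)
exists (2^-1 / Y); first by rewrite divr_gt0.
exists (2 * Pw + 4 * `|C|); first by rewrite addr_ge0 ?mulr_ge0.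
move=> t j e tr jH e0.
have tr2 : `|t - target| <= 2^-1.
  by rewrite (le_trans tr)// ler_pdivrMr// ler_peMr.
have [kj|kj] := boolP (kink j).
  apply: (@le_trans _ _ (4 * `|C| * e)).
    apply: wint_affine_small => //.
      move=> x Ix; apply: le_trans (ler_norm _) _.
      by rewrite (le_trans (pC _ Ix))// ler_norm.
    have := coord_norm (t - target) j; rewrite coordB param_weight//.
    rewrite /target_weight kink_neq1// kj => h.
    by move: (le_trans h tr2); rewrite ler_norml => /andP[h1 _]; lra.
  by rewrite [leRHS]mulrDl lerDr !mulr_ge0.
have far x : I x -> 2^-1 <= `|preact t j x|.
  move=> Ix.
  have h1 : 1 <= `|preact target j x|.
    have [j1|j1] := eqVneq j 1%N.
      by subst j; rewrite (le_trans (preact_target_first Ix))// ler_norm.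
    by rewrite preact_target_inactive ?normrN ?normr1// negb_or j1.
  have h2 : `|preact (t - target) j x| <= 2^-1.
    rewrite (le_trans (preact_norm _ _ _))//.
    rewrite (le_trans (ler_wpM2l (normr_ge0 _) (itv_norm_bound Ix)))//.
    by rewrite -ler_pdivlMr.
  have h3 : `|preact target j x| <= `|preact t j x| + `|preact (t - target) j x|.
    have := ler_normB (preact t j x) (preact t j x - preact target j x).
    by rewrite subKr -preactB.
  by lra.
(* Below 1/2 the set is empty; from 1/2 on, the total mass is at most [2 * Pw * e]. *)
have [e2|e2] := ltP e 2^-1.
  rewrite (@eq_wint _ _ _ _ _ (fun=> 0)) ?wint0 ?mulr_ge0 ?addr_ge0 ?mulr_ge0//.
  by move=> x /far h; rewrite leNgt (lt_le_trans e2 h).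
apply: (@le_trans _ _ Pw).
  apply: wint_le => //.
  - exact: bounded_measurable_small.
  - exact: bounded_measurable_cst.
  - by move=> x _; rewrite lern1 leq_b1.
have h1 : Pw <= 2 * Pw * e by nra.
by rewrite [leRHS]mulrDl (le_trans h1)// lerDl !mulr_ge0.
Qed.

Lemma target_lojasiewicz : exists2 rho : R, 0 < rho & exists2 m : R, 0 < m &
  forall t, `|t - target| <= rho ->
    m * risk a b f p relu t <= `|risk_gradient a b f p relu step t| ^+ 2.
Proof.
have [N1 NH] := andP hN.
have [rho0 rho00 [kappa kappa0 transv]] := target_transversal.
have [||nu nu0 hnu] := @uniform_lower_constant R H
    (fun k e => (1 <= k)%N -> 2 * e <= `|coord target (2 * H + k)|).
- by move=> k e e' h e'e k1; apply: le_trans (h k1); rewrite ler_wpM2l.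
- move=> k kH; have [k0|k0] := posnP k; first by exists 1 => //; rewrite k0.
  have v0 : 0 < `|coord target (2 * H + k)|.
    rewrite param_outer ?k0// normr_gt0 /target_outer.
    by case: ifP => [/andP[_ h]|_]; rewrite ?subr_eq0 ?oner_neq0.
  exists (`|coord target (2 * H + k)| / 2); first by rewrite divr_gt0.
  by move=> _; rewrite mulrC divfK.
have [||eta1 eta10 heta1] := @uniform_lower_constant R N
    (fun k e => (1 <= k)%N -> e <= (xs k - xs k.-1) / 3).
- by move=> k e e' h e'e k1; apply: le_trans (h k1).
- move=> k kN; have [k0|k0] := posnP k; first by exists 1 => //; rewrite k0.
  exists ((xs k - xs k.-1) / 3) => //.
  by rewrite divr_gt0// subr_gt0 hxs// k0.
(* The value 1 suits the first and the inactive neurons; [eta1] is at most a third of every piece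
   and suits the kink neurons. *)
pose eta := Num.min 1 eta1.
have eta0 : 0 < eta by rewrite lt_min ltr01.
have eta_1 : eta <= 1 by rewrite ge_min lexx.
have eta_k k : (1 <= k <= N)%N -> eta <= (xs k - xs k.-1) / 3.
  move=> /andP[k1 kN]; apply: le_trans (heta1 k kN k1).
  by rewrite ge_min lexx orbT.
have bf : bounded_measurable a b f.
  have [mN [K NK]] : bounded_measurable a b (realization relu target).
    by apply: bounded_measurable_realization; exact: continuous_relu.
  split; last by exists K => x Ix; rewrite realization_target// NK.
  apply: eq_measurable_fun mN => x /set_mem Ix.
  by rewrite realization_target.
(* The pieces are the middle thirds of the intervals between knots, which lie at distance at least
   [eta] from every knot. *)
apply: (@lojasiewicz R H a b f p bf bp c c_gt0 cp (leq_trans N1 NH) target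
  realization_target nu nu0 _ N active _ _
  (fun k => (2 * xs k.-1 + xs k) / 3) (fun k => (xs k.-1 + 2 * xs k) / 3) _
  eta eta0 _ _ _ _ kappa kappa0 _ NH).
- by move=> j /andP[j1 jH]; exact: hnu.
- by rewrite /active eqxx.
- by move=> j _; exact: active_le.
- move=> k /andP[k1 kN]; have hk : xs k.-1 < xs k by rewrite hxs// k1.
  have ak : a <= xs k.-1 by rewrite -hx0 knots_monotone// (leq_trans (leq_pred _) kN).
  have bk : xs k <= b by rewrite -hxN knots_monotone// kN leqnn.
  by split; lra.
- move=> k j x kN /andP[j1 jk] jH /orP[/eqP jE|kj] /andP[lx xh].
    subst j; apply: (le_trans eta_1); apply: preact_target_first.
    move: kN => /andP[k1 kN]; have hk : xs k.-1 < xs k by rewrite hxs// k1.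
    have ak : a <= xs k.-1 by rewrite -hx0 knots_monotone// (leq_trans (leq_pred _) kN).
    have bk : xs k <= b by rewrite -hxN knots_monotone// kN leqnn.
    by rewrite /= in_itv/=; apply/andP; split; lra.
  rewrite preact_target_kink ?j1//.
  have := eta_k k kN; move: kN => /andP[k1 kN].
  have : xs j.-1 <= xs k.-1.
    by rewrite knots_monotone// (leq_trans (leq_pred _) kN) andbT -!subn1 leq_sub2r.
  by lra.
- move=> k j x kN /andP[kj jH] aj /andP[lx xh].
  have [k1 kN'] := andP kN.
  have kj' : kink j.
    by move: aj => /orP[/eqP j1|//]; move: kj; rewrite j1 ltnS leqNgt k1.
  rewrite preact_target_kink ?(leq_ltn_trans _ kj)//.
  have := eta_k k kN.
  have : xs k <= xs j.-1.
    have jN := active_le aj; apply: knots_monotone.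
    by case: j kj jN {jH aj kj'} => // j kj /ltnW jN /=; rewrite -ltnS kj.
  by lra.
- by move=> j x jH aj Ix; rewrite preact_target_inactive// lerN2.
- by move=> x Ix; apply: le_trans (preact_target_first Ix).
- by move=> j e; apply: transv; rewrite subrr normr0 ltW.
Qed.

End target.

(** * Measurability and the Gaussian start *)

Lemma lipschitz_within_continuous (R : realType) (a b : R) (p : R -> R) :
  [lipschitz p x | x in `[a, b]] -> {within `[a, b], continuous p}.
Proof.
move=> [M [_ lipM]]; have pM := lipM (`|M| + 1) (ltr_pwDr ltr01 (ler_norm M)).
apply/subspace_continuousP => x Ix; apply/cvgrPdist_le => e e0.
have M0 : 0 < `|M| + 1 by rewrite ltr_wpDl.
rewrite near_withinE; near=> y => Iy.
have /= h := pM (x, y) (conj Ix Iy).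
rewrite (le_trans h)// mulrC -ler_pdivlMr//.
by near: y; apply: cvgr_dist_le; [exact: cvg_id|exact: divr_gt0].
Unshelve. all: by end_near. Qed.

Section random_vectors.
Context {R : realType} {d : measure_display} {Omega : measurableType d}
  (P : probability Omega R) {n : nat}.

Lemma measurable_random_vector (X : Omega -> 'rV[R]_n.+1)
    (F : 'rV[R]_n.+1 -> R) : random_vector X -> continuous F ->
  measurable_fun setT (fun w => F (X w)).
Proof.
move=> rX cF mT; apply: (measurability _ (RGenOInfty.measurableE R)) => //.
move=> _ [_ [z ->] <-]; rewrite setTI.
apply: (rX (F @^-1` `]z, +oo[)); apply: sub_sigma_algebra.
by apply: open_comp => [x _|]; [exact: cF|exact: interval_open].
Qed.

Lemma continuous_dist_rV (t0 : 'rV[R]_n.+1) : continuous (fun u : 'rV[R]_n.+1 => `|u - t0|).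
Proof.
move=> u; apply/(@cvgrPdist_le _ _ _ _ (nbhs_filter u)) => e e0.
apply/nbhs_ballP; exists e => // v; rewrite -ball_normE /= => /ltW uv.
by rewrite (le_trans (ler_dist_dist _ _))// opprB addrA subrK.
Qed.

(** The continuous positive density attains a positive minimum on the compact interval. *)
Lemma normal_prob_itv_gt0 (l u : R) : l < u ->
  exists2 m : R, 0 < m & normal_prob 0 1 `[l, u] = m%:E.
Proof.
move=> lu; have cpdf : {within `[l, u], continuous (@normal_pdf R 0 1)}.
  by apply: continuous_subspaceT; apply: continuous_normal_pdf; exact: oner_neq0.
have [z _ hz] := EVT_min (ltW lu) cpdf.
have pz : 0 < normal_pdf 0 1 z :> R.
  rewrite normal_pdfE ?oner_neq0// mulr_gt0 ?normal_peak_gt0 ?oner_neq0//.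
  exact: expR_gt0.
have fin : normal_prob 0 1 `[l, u]%classic \is a @fin_num R.
  exact: (fin_num_measure (normal_prob 0 1)).
suff h : ((normal_pdf 0 1 z * (u - l))%:E <= normal_prob 0 1 `[l, u]%classic)%E.
  exists (fine (normal_prob 0 1 `[l, u]%classic)); last by rewrite fineK.
  apply: (@lt_le_trans _ _ (normal_pdf 0 1 z * (u - l))).
    by rewrite mulr_gt0 ?subr_gt0.
  by rewrite -lee_fin fineK.
rewrite /normal_prob (_ : (_ * _)%:E =
    (\int[lebesgue_measure]_(x in `[l, u]) (normal_pdf 0 1 z)%:E)%E); last first.
  by rewrite integral_cst//= lebesgue_measure_itv/= lte_fin lu -EFinB -EFinM.
apply: ge0_le_integral => //.
- by move=> x _; rewrite lee_fin normal_pdf_ge0.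
- apply/measurable_EFinP; apply: measurable_funTS; exact: measurable_normal_pdf.
Qed.

(** Balls of the sup norm are boxes, so the product formula applies. The bound is chosen before [X],
    hence is uniform in the learning rate. *)
Lemma standard_normal_ball (t0 : 'rV[R]_n.+1) (e : R) : 0 < e ->
  exists2 m : R, 0 < m & forall X : Omega -> 'rV[R]_n.+1,
    standard_normal P X -> (m%:E <= P [set w | (`|X w - t0| <= e)%R])%E.
Proof.
move=> e0; pose B i : set R := `[t0 ord0 i - e, t0 ord0 i + e]%classic.
have hB i : exists2 m : R, 0 < m & normal_prob 0 1 (B i) = m%:E.
  by apply: normal_prob_itv_gt0; rewrite ltrBlDr -addrA ltrDl addr_gt0.
have [|m hm] := @boolp.choice 'I_n.+1 R
    (fun i m => 0 < m /\ normal_prob 0 1 (B i) = m%:E).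
  by move=> i; have [m m0 mB] := hB i; exists m.
exists (\prod_i m i); first by apply: prodr_gt0 => i _; have [] := hm i.
move=> X nX.
have -> : [set w | `|X w - t0| <= e] = [set w | forall i, B i (X w ord0 i)].
  apply/seteqP; split => w /= h.
    move=> i; rewrite /B /= in_itv/= -ler_distl.
    by rewrite (le_trans _ h)// (le_trans _ (rV_norm_ge _ i))// !mxE.
  apply: rV_norm_le => [|i]; first exact: ltW.
  by have := h i; rewrite /B /= in_itv/= -ler_distl !mxE.
rewrite nX; last by move=> i; exact: measurable_itv.
rewrite -prodEFin le_eqVlt; apply/orP; left; apply/eqP.
by apply: eq_bigr => i _; have [_ ->] := hm i.
Qed.

End random_vectors.

(** * The generalized gradient and convergence near the minimizer *)

Lemma rV_sqr_norm_le_sum (R : realType) (n : nat) (u : 'rV[R]_n) :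
  `|u| ^+ 2 <= \sum_i u ord0 i * u ord0 i.
Proof.
have s0 : 0 <= \sum_i u ord0 i * u ord0 i.
  by apply: sumr_ge0 => i _; rewrite -expr2 sqr_ge0.
rewrite -(sqr_sqrtr s0) lerXn2r ?nnegrE ?sqrtr_ge0//.
apply: rV_norm_le => [|i]; first exact: sqrtr_ge0.
rewrite -sqrtr_sqr ler_wsqrtr// expr2 (bigD1 i)//= lerDl.
by apply: sumr_ge0 => j _; rewrite -expr2 sqr_ge0.
Qed.

(** The smooth gradients converge at every parameter, so [G] is determined everywhere. *)
Lemma generalized_gradient (R : realType) (H : nat) (a b : R) (f p : R -> R)
    (A : nat -> R -> R) (Aoo : R -> R) (L : nat -> 'rV[R]_(3 * H).+1 -> R)
    (G : 'rV[R]_(3 * H).+1 -> 'rV[R]_(3 * H).+1) :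
  bounded_measurable a b f -> bounded_measurable a b p ->
  (forall r, (1 <= r)%N -> C1 (A r)) ->
  (forall x : R,
     (ereal_sup [set ereal_sup [set `|(A r)^`()%classic y|%:E
                               | y in `[(- `|x|)%R, `|x|%R]]
                | r in [set r : nat | (1 <= r)%N]] < +oo)%E) ->
  (forall x : R,
     limn_esup (fun r : nat =>
       (`|A r x - Aoo x| + `|(A r)^`()%classic x - \1_(`]0, +oo[%classic) x|)%:E)
     = 0%E) ->
  (forall r, (1 <= r)%N -> forall t, L r t = risk a b f p (A r) t) ->
  (forall t, cvgn (fun r => gradient (L r) t) ->
     G t = limn (fun r => gradient (L r) t)) ->
  forall t, G t = risk_gradient a b f p Aoo step t.
Proof.
move=> bf bp AC1 Abound Alim hL hG t.
have gradL : gradient (L r) t @[r --> \oo] --> risk_gradient a b f p Aoo step t.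
  (* Nothing is assumed at index 0; shifting the sequence by one makes all hypotheses available. *)
  rewrite -(cvg_shiftS (fun r => gradient (L r) t)) /=.
  rewrite (_ : (fun r => gradient (L r.+1) t) = fun r =>
      risk_gradient a b f p (A r.+1) ((A r.+1)^`()%classic) t); last first.
    apply/funext => r; rewrite -gradient_risk//; last exact: AC1.
    by congr gradient; apply/funext => t'; rewrite hL.
  apply: (cvg_risk_gradient (A_ := fun r => A r.+1)
    (dA_ := fun r => (A r.+1)^`()%classic)) => //.
  - by move=> y; rewrite (cvg_shiftS (A ^~ y)); exact: activation_cvg.
  - move=> y; rewrite (cvg_shiftS (fun r => (A r)^`()%classic y)).
    exact: activation_deriv_cvg.
  - move=> r y; apply: differentiable_continuous; apply/derivable1_diffP.
    by have [+ _] := AC1 r.+1 isT; exact.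
  - by move=> r; have [_] := AC1 r.+1 isT.
  - exact: activation_bound.
  - exact: activation_deriv_bound.
have cL : cvgn (fun r => gradient (L r) t) by apply/cvg_ex; eexists; exact: gradL.
by rewrite (hG t cL); apply: cvg_lim.
Qed.

Section local_convergence.
Context {R : realType} {H : nat} (a b : R) (f p : R -> R).
Local Notation I := (`[a, b]%classic : set R).
Context (bf : bounded_measurable a b f) (bp : bounded_measurable a b p)
  (p0 : forall x, I x -> 0 <= p x).
Local Notation L := (@risk R H a b f p relu).
Local Notation G := (@risk_gradient R H a b f p relu step).

Lemma continuous_risk : continuous L.
Proof.
move=> t; apply/(@cvgrPdist_le _ _ _ _ (nbhs_filter t)) => e e0.
have [K K0 lipK] := @risk_lipschitz R H a b f p bf bp p0 `|t : 'rV[R]_(3 * H).+1|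
  (normr_ge0 _).
have K1 : 0 < K + 1 by rewrite ltr_wpDl.
apply/nbhs_ballP; exists (Num.min 1 (e / (K + 1))) => /=.
  by rewrite lt_min ltr01 divr_gt0.
move=> u; rewrite -ball_normE /= lt_min distrC => /andP[/ltW h1 /ltW h2].
have := lipK t (u - t) (lexx _) h1; rewrite (addrC t) subrK distrC => /le_trans; apply.
apply: (@le_trans _ _ ((K + 1) * `|u - t|)).
  by rewrite ler_wpM2r// lerDl.
by rewrite mulrC -ler_pdivlMr.
Qed.

Lemma local_convergence (t0 : 'rV[R]_(3 * H).+1) (rho1 rho2 m kappa : R) :
  0 < rho1 -> 0 < rho2 -> 0 < m -> 0 <= kappa -> L t0 = 0 ->
  (forall t, `|t - t0| <= rho1 -> m * L t <= `|G t| ^+ 2) ->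
  (forall t j e, `|t - t0| <= rho2 -> (1 <= j <= H)%N -> 0 <= e ->
    wint a b p (fun x => (`|preact t j x| <= e)%R%:R) <= kappa * e) ->
  exists c d : R, [/\ 0 < c, 0 < d & forall gamma theta,
    0 < gamma <= c -> `|theta 0%N - t0| <= d ->
    (forall n, theta n.+1 = theta n - gamma *: G (theta n)) ->
    forall n, L (theta n) <= expR (- c * gamma * n%:R)].
Proof.
move=> rho10 rho20 m0 kappa0 Lt0 PL transv.
pose rho := Num.min rho1 rho2; pose B := `|t0| + rho.
have rho0 : 0 < rho by rewrite lt_min rho10.
have B0 : 0 <= B by rewrite addr_ge0// ltW.
have tB t : `|t - t0| <= rho -> `|t| <= B.
  move=> tr; rewrite -(subrK t0 t) addrC (le_trans (ler_normD _ _))// lerD2l//.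
have [K K0 descent] := @risk_descent R H a b f p bf bp p0 B kappa B0 kappa0.
have [Bg Bg0 GB] := @risk_gradient_bound R H a b f p bf bp p0 B B0.
apply: (@gradient_descent_converges _ _ L G t0 rho (Num.sqrt m) K Bg) => //.
- by rewrite sqrtr_gt0.
- by move=> t; exact: risk_ge0.
- move=> e e0; have /cvgrPdist_le/(_ e e0) := @continuous_risk t0.
  move=> /nbhs_ballP[dl /= dl0 hd]; exists (dl / 2); first by rewrite divr_gt0.
  move=> t tdl; have : `|L t0 - L t| <= e.
    apply: hd; rewrite -ball_normE /= distrC (le_lt_trans tdl)//.
    by rewrite ltr_pdivrMr// mulr2n mulrDr mulr1 ltrDl.
  by rewrite Lt0 sub0r normrN; apply: le_trans; exact: ler_norm.
- move=> t tr; rewrite sqr_sqrtr ?(ltW m0)//; apply: PL.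
  by rewrite (le_trans tr)// ge_min lexx.
- by move=> t tr; apply: GB; exact: tB.
- move=> t gamma tr gamma0 g1.
  have nE : `|- (gamma *: G t)| = gamma * `|G t|.
    by rewrite normrN normrZ gtr0_norm.
  have := descent t (- (gamma *: G t)) (tB _ tr); rewrite nE => /(_ g1) h.
  apply: (le_trans (h _)) => {h}.
    move=> j e jH e0; apply: transv => //.
    by rewrite (le_trans tr)// ge_min lexx orbT.
  (* What remains compares the Euclidean square of the gradient, produced by the scalar product,
     with the square of its sup norm. *)
  rewrite lerD2r lerD2l.
  rewrite (_ : \sum_i _ = - (gamma * \sum_i G t ord0 i * G t ord0 i)).
    by rewrite lerN2 ler_wpM2l ?(ltW gamma0)// rV_sqr_norm_le_sum.
  by rewrite mulr_sumr -sumrN; apply: eq_bigr => i _; rewrite !mxE; ring.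
Qed.

End local_convergence.

Unset Implicit Arguments.

(** * Exponential decay with positive probability *)

Theorem theorem1p2 (R : realType) (H N : nat)
  (hH : (0 < H)%N) (hN : (1 <= N <= H)%N)
  (xs : nat -> R) (a b : R) (hab : a < b)
  (hx0 : xs 0%N = a) (hxN : xs N = b)
  (hxs : forall i : nat, (1 <= i <= N)%N -> xs i.-1 < xs i)
  (f : R -> R) (hf : {within `[a, b], continuous f})
  (hfaff : forall i : nat, (1 <= i <= N)%N -> affine_on `[xs i.-1, xs i] f)
  (* activation functions R_r, r in {1, 2, ...}, and R_oo *)
  (A : nat -> R -> R) (Aoo : R -> R)
  (hAcont : forall r : nat, (1 <= r)%N -> continuous (A r))
  (hAoocont : continuous Aoo)
  (hAC1 : forall r : nat, (1 <= r)%N -> C1 (A r))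
  (hAoo : forall x : R, Aoo x = Num.max x 0)
  (hAbound : forall x : R,
     (ereal_sup [set ereal_sup [set `|(A r)^`()%classic y|%:E
                               | y in `[(- `|x|)%R, `|x|%R]]
                | r in [set r : nat | (1 <= r)%N]] < +oo)%E)
  (hAlim : forall x : R,
     limn_esup (fun r : nat =>
       (`|A r x - Aoo x| + `|(A r)^`()%classic x - \1_(`]0, +oo[%classic) x|)%:E)
     = 0%E)
  (p : R -> R) (hp0 : forall x : R, x \in `[a, b] -> 0 < p x)
  (hpLip : [lipschitz p x | x in `[a, b]])
  (L : nat -> 'rV[R]_(3 * H).+1 -> R) (Loo : 'rV[R]_(3 * H).+1 -> R)
  (hL : forall r : nat, (1 <= r)%N ->
     forall theta : 'rV[R]_(3 * H).+1, L r theta = risk a b f p (A r) theta)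
  (hLoo : forall theta : 'rV[R]_(3 * H).+1,
     Loo theta = risk a b f p Aoo theta)
  (d : measure_display) (Omega : measurableType d) (P : probability Omega R)
  (Theta : R -> nat -> Omega -> 'rV[R]_(3 * H).+1)
  (hTheta : forall (gamma : R) (n : nat), random_vector (Theta gamma n))
  (hTheta0 : forall gamma : R, standard_normal P (Theta gamma 0%N))
  (G : 'rV[R]_(3 * H).+1 -> 'rV[R]_(3 * H).+1)
  (hG : forall theta : 'rV[R]_(3 * H).+1,
     cvgn (fun r : nat => gradient (L r) theta) ->
     G theta = limn (fun r : nat => gradient (L r) theta))
  (hGD : forall (gamma : R) (n : nat) (w : Omega),
     Theta gamma n.+1 w =
     Theta gamma n w - gamma *: G (Theta gamma n w)) :
  exists c C : R, [/\ 0 < c, 0 < C &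
    forall gamma : R, 0 < gamma <= c ->
      [/\ (P [set w | limn_esup (fun n : nat => (Loo (Theta gamma n w))%:E)
                      = 0%E] >=
           P [set w | forall n : nat,
                (Loo (Theta gamma n w) <= C * expR (- c * gamma * n%:R))%R])%E,
          (P [set w | forall n : nat,
                (Loo (Theta gamma n w) <= C * expR (- c * gamma * n%:R))%R]
           >= c%:E)%E
        & 0 < c]].
Proof.
have [N1 NH] := andP hN.
have cp := lipschitz_within_continuous hpLip.
have bp := bounded_measurable_cont cp.
have bf := bounded_measurable_cont hf.
have [z zI zmin] := EVT_min (ltW hab) cp.
have pz : 0 < p z by exact: hp0.
have pge x : `[a, b]%classic x -> p z <= p x by exact: zmin.
have p0 x : `[a, b]%classic x -> 0 <= p x.
  by move=> /pge; apply: le_trans; exact: ltW.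
have AooE : Aoo = relu by apply/funext => x; rewrite hAoo.
subst Aoo.
have Gt := generalized_gradient bf bp hAC1 hAbound hAlim hL hG.
(* Slopes and intercepts of all pieces are chosen at once; indices outside the range receive the
   dummy pair [(0, 0)]. *)
have [|uv huv] := @boolp.choice nat (R * R) (fun i uv => (1 <= i <= N)%N ->
    forall x, xs i.-1 <= x <= xs i -> f x = uv.1 * x + uv.2).
  move=> i; have [iN|/negP niN] := boolP (1 <= i <= N)%N; last by exists (0, 0).
  have [u [v fuv]] := hfaff i iN; exists (u, v) => _ x xi.
  by apply: fuv; rewrite /= in_itv.
pose t0 : 'rV[R]_(3 * H).+1 :=
  target N xs a b (fun i => (uv i).1) (fun i => (uv i).2).
have [rho1 rho10 [m m0 PL]] := target_lojasiewicz hN hx0 hxN hxs huv bp pz pge.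
have [rho2 rho20 [kappa kappa0 transv]] := @target_transversal R H N hN xs a b
  (fun i => (uv i).1) (fun i => (uv i).2) p bp (p z) pz pge.
have ft0 := realization_target hN hx0 hxN hxs huv.
have Lt0 : risk a b f p relu t0 = 0.
  rewrite riskE -[RHS](wint0 bp); apply: eq_wint => x Ix.
  by rewrite (ft0 x Ix) subrr expr0n.
have [c [d0 [c0 d00 conv]]] :=
  local_convergence bf bp p0 rho10 rho20 m0 kappa0 Lt0 PL transv.
have [q q0 hq] := standard_normal_ball P t0 d00.
(* One constant serves as decay rate, as bound on the learning rate and as lower bound [q] on the
   probability of a start near [t0]. *)
pose k := Num.min c q.
have k0 : 0 < k by rewrite lt_min c0.
exists k, 1; split => // gamma /andP[gamma0 gammak].
have LooE : Loo = risk a b f p relu by apply/funext.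
subst Loo.
have mL n : measurable_fun setT (fun w => risk a b f p relu (Theta gamma n w)).
  apply: measurable_random_vector; first exact: hTheta.
  exact: continuous_risk.
pose E1 := [set w | forall n, risk a b f p relu (Theta gamma n w) <=
  1 * expR (- k * gamma * n%:R)].
have mE1 : measurable E1.
  rewrite (_ : E1 = \bigcap_n ((fun w => risk a b f p relu (Theta gamma n w)) @^-1`
      `]-oo, 1 * expR (- k * gamma * n%:R)])); last first.
    by apply/seteqP; split => w /= h n; have := h n; rewrite /= in_itv/=; auto.
  apply: bigcap_measurable => // n _; rewrite -[X in measurable X]setTI.
  by apply: mL => //; exact: measurable_itv.
pose E2 := [set w | limn_esup (fun n =>
  (risk a b f p relu (Theta gamma n w))%:E) = 0%E].
have mE2 : measurable E2.
  rewrite (_ : E2 = (fun w => limn_esup (fun n =>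
    (risk a b f p relu (Theta gamma n w))%:E)) @^-1` [set 0%E])//.
  rewrite -[X in measurable X]setTI; apply: measurable_fun_limn_esup => //.
  by move=> n; apply/measurable_EFinP.
(* The bound is a geometric sequence with ratio [expR (- k * gamma) < 1], so the nonnegative risks
   converge to 0. *)
have E12 : E1 `<=` E2.
  move=> w hw; apply: (cvg_limn_einf_sup _).2.
  apply: cvg_EFin; first exact: nearW.
  have e1 : `|expR (- k * gamma)| < 1.
    by rewrite ger0_norm ?expR_ge0// expR_lt1 mulNr oppr_lt0 mulr_gt0.
  apply/cvgrPdist_le => e e0; have /cvgrPdist_le/(_ e e0) := cvg_expr e1.
  apply: filterS => n; rewrite !sub0r !normrN => /=; apply: le_trans.
  rewrite ger0_norm ?risk_ge0// ger0_norm ?exprn_ge0 ?expR_ge0//.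
  by have := hw n; rewrite mul1r expRM_natr.
split => //; first by apply: le_measure; rewrite ?inE.
pose E0 := [set w | `|Theta gamma 0%N w - t0| <= d0].
have mE0 : measurable E0.
  rewrite (_ : E0 = (fun w => `|Theta gamma 0%N w - t0|) @^-1` `]-oo, d0]); last first.
    by apply/seteqP; split => w; rewrite /= in_itv/=.
  rewrite -[X in measurable X]setTI.
  have mD := measurable_random_vector (hTheta gamma 0%N) (@continuous_dist_rV R _ t0).
  by apply: mD => //; exact: measurable_itv.
apply: (@le_trans _ _ (P E0)).
  by apply: le_trans (hq _ (hTheta0 gamma)); rewrite lee_fin ge_min lexx orbT.
apply: le_measure; rewrite ?inE// => w hw n.
apply: (@le_trans _ _ (expR (- c * gamma * n%:R))).
  apply: (conv gamma (fun n => Theta gamma n w)) => //.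
    by rewrite gamma0 (le_trans gammak)// ge_min lexx.
  by move=> i; rewrite hGD Gt.
(* Passing from the rate [c] to the smaller [k] only weakens the bound. *)
rewrite mul1r ler_expR !mulNr lerN2 -!mulrA ler_wpM2r//.
  by rewrite mulr_ge0// ltW.
by rewrite ge_min lexx.
Qed.
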